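(* Let $(X,d_X)=(\mathcal P_2(\mathbb{R}^d),\mathcal W_2)$ and $\lambda>0$, and consider $E:X\to(-\infty,\infty]$ of the form $E(\rho)=H(\rho)+\int V\,d\rho$, where $V:\mathbb{R}^d\to\mathbb{R}$ is a $\lambda$-convex function with bounded second derivatives. Let $Y\subset X$. Assume that $E$ is bounded from below with nonempty domain $D(E)=\{E<\infty\}$, and that for each $y\in Y\cap D(E)$ there exists an $\mathrm{EVI}_\lambda$-flow $(\gamma^y_t)_{t>0}$ of $E$ in $(X,d_X)$ which starts from $y$, such that $\gamma^y_t\in Y$ for each $t>0$. Assume also that there exists $y_*\in Y$ such that $E(y_* )=\inf_{x\in X}E(x)$. Then every pair $y_1,y_2\in Y$ can be connected by a curve of finite length in $Y$; that is, $d_Y(y_1,y_2)<\infty$.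
   Context: $\mathcal P_2(\mathbb{R}^d)$: Borel probability measures on $\mathbb{R}^d$ with finite second moment, with the 2-Wasserstein distance $\mathcal W_2$. Differential entropy: $H(\rho)=\int\rho\log\rho\,dx\in(-\infty,\infty]$ if $\rho\in\mathcal P_2(\mathbb{R}^d)$ has a density (also denoted $\rho$), and $H(\rho)=\infty$ otherwise. $V$ is $\lambda$-convex if $V-\frac\lambda2|\cdot|^2$ is convex. Absolutely continuous curves: for a bounded interval $I$ and $p\in[1,\infty]$, $AC^p(I;(X,d_X))$ is the set of maps $\gamma:I\to X$ for which there is $m\in L^p(I)$ with $d_X(\gamma_s,\gamma_t)\le\int_s^tm(u)\,du$ for all $s<t$ in $I$; $AC:=AC^1$. The metric derivative is $|\dot\gamma|_t=\limsup_{s\to t}d_X(\gamma_s,\gamma_t)/|s-t|$. $AC^2_{\rm loc}((0,\infty);(X,d_X))$ consists of maps $\gamma:(0,\infty)\to X$ whose restriction to each bounded interval $I\subset(0,\infty)$ is in $AC^2(I;(X,d_X))$. $\mathrm{EVI}_\lambda$-flow: $\gamma\in AC^2_{\rm loc}((0,\infty);(X,d_X))$ is an $\mathrm{EVI}_\lambda$-flow of $E$ in $(X,d_X)$ if $t\mapsto E(\gamma_t)$ is lower semicontinuous and finite-valued, and for all $x\in D(E)$ and all $t>0$, $$\frac12\frac{d^+}{dt}d_X^2(\gamma_t,x)+\frac\lambda2d_X^2(\gamma_t,x)\le E(x)-E(\gamma_t),$$ where $d^+/dt$ is the upper right derivative. It starts from $x\in D(E)$ if $d_X(\gamma_t,x)\to0$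 as $t\downarrow0$ and $\liminf_{t\downarrow0}E(\gamma_t)\ge E(x)$. Induced length metric on $Y\subset X$: $d_Y(y,y')=\inf\int_0^1|\dot\gamma|_t\,dt$ over $\gamma\in AC([0,1];(X,d_X))$ with $\gamma_t\in Y$ for all $t$, $\gamma_0=y$, $\gamma_1=y'$ ($\inf\emptyset=+\infty$).
   Formalization: Flows staying in Y are assumed for each y in Y∩closure of D(E), not only Y∩D(E): otherwise Y={y_*,δ_0} with V=λ|x|²/2 and y_* the Gaussian minimiser is a counterexample (d≥1); flows need be AC² only on compact intervals of (0,∞). *)

(* Defs.v *)
From HB Require Import structures.
From mathcomp Require Import all_boot all_order all_algebra.
From mathcomp Require Import all_classical all_reals all_analysis.

Set Implicit Arguments.
Unset Strict Implicit.
Unset Printing Implicit Defensive.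

Import Order.TTheory GRing.Theory Num.Theory.
Import numFieldNormedType.Exports.

Local Open Scope classical_set_scope.
Local Open Scope ring_scope.

(** The sigma-algebra on ['rV[R]_d] is the one generated by the coordinates
    (as the library does for tuples); it is the Borel sigma-algebra. *)

Definition measure_rV_display : measure_display -> measure_display.
Proof. exact. Qed.

Section measurable_rV.
Context (R : realType) (d : nat).

Definition rV_coor (i : 'I_d) (x : 'rV[R]_d) : R := x ord0 i.

Let rV_set0 : g_sigma_preimage rV_coor set0.
Proof. exact: sigma_algebra0. Qed.

Let rV_setC A : g_sigma_preimage rV_coor A -> g_sigma_preimage rV_coor (~` A).
Proof. exact: sigma_algebraC. Qed.

Let rV_bigcup (F : (set 'rV[R]_d)^nat) :
  (forall i, g_sigma_preimage rV_coor (F i)) ->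
  g_sigma_preimage rV_coor (\bigcup_i F i).
Proof. exact: sigma_algebra_bigcup. Qed.

HB.instance Definition _ :=
  @isMeasurable.Build (measure_rV_display default_measure_display)
    'rV[R]_d (g_sigma_preimage rV_coor) rV_set0 rV_setC rV_bigcup.

Lemma measurable_rV_coor (i : 'I_d) : measurable_fun [set: 'rV[R]_d] (rV_coor i).
Proof.
move=> _ Y mY; rewrite setTI; apply: sub_sigma_algebra => /=.
rewrite -bigcup_seq/=; exists i => /=; first by rewrite mem_index_enum.
by exists Y => //; rewrite setTI.
Qed.

Lemma measurable_fun_rV d1 (T1 : measurableType d1) (f : T1 -> 'rV[R]_d) :
  (forall i, measurable_fun [set: T1] (rV_coor i \o f)) ->
  measurable_fun [set: T1] f.
Proof.
move=> mf _ Y mY; rewrite setTI.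
suff : g_sigma_preimage rV_coor `<=` [set A | measurable (f @^-1` A)] by exact.
apply: smallest_sub => [|A].
  split=> /= [|A mA|F mF].
  - by rewrite preimage_set0.
  - by rewrite setTD preimage_setC; exact: measurableC.
  - by rewrite preimage_bigcup; exact: bigcupT_measurable.
rewrite -bigcup_seq/= => -[i _ [B mB <-]].
by rewrite setTI; have := mf i measurableT B mB; rewrite setTI.
Qed.

End measurable_rV.

Lemma sigma_finite_product_measure1 d1 d2 (T1 : measurableType d1)
    (T2 : measurableType d2) (R : realType)
    (m1 : {sigma_finite_measure set T1 -> \bar R})
    (m2 : {sigma_finite_measure set T2 -> \bar R}) :
  sigma_finite setT (m1 \x m2)%E.
Proof.
have /sigma_finiteP[F [TF ndF Foo]] := sigma_finiteT m1.
have /sigma_finiteP[G [TG ndG Goo]] := sigma_finiteT m2.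
exists (fun n => F n `*` G n).
  rewrite -setXTT TF TG predeqE => -[x y]; split.
    move=> [/= [n _ Fnx] [k _ Gky]]; exists (maxn n k) => //; split.
    - by move: x Fnx; exact/subsetPset/ndF/leq_maxl.
    - by move: y Gky; exact/subsetPset/ndG/leq_maxr.
  by move=> [n _ []/= ? ?]; split; exists n.
move=> k; have [? ?] := Foo k; have [? ?] := Goo k.
split; first exact: measurableX.
by rewrite product_measure1E// lte_mul_pinfty// ge0_fin_numE.
Qed.

Section lebesgue_rV_succ.
Context (R : realType) (d : nat).
Variable m : {sigma_finite_measure set 'rV[R]_d -> \bar R}.

Definition rV_cons (p : measurableTypeR R * 'rV[R]_d) : 'rV[R]_d.+1 :=
  \row_i (if unlift ord0 i is Some j then p.2 ord0 j else p.1).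

Let rV_uncons (x : 'rV[R]_d.+1) : measurableTypeR R * 'rV[R]_d :=
  (x ord0 ord0, \row_i x ord0 (lift ord0 i)).

Let rV_consK : cancel rV_cons rV_uncons.
Proof.
move=> [a v]; rewrite /rV_cons /rV_uncons mxE unlift_none; congr pair.
by apply/rowP => i; rewrite !mxE liftK.
Qed.

Lemma measurable_rV_cons : measurable_fun setT rV_cons.
Proof.
apply: measurable_fun_rV => i; case: (unliftP ord0 i) => [j ->|->].
  apply: (eq_measurable_fun (rV_coor j \o snd)) => [[a v] _ /=|].
    by rewrite /rV_coor mxE liftK.
  by apply: measurableT_comp => //; exact: measurable_rV_coor.
apply: (eq_measurable_fun fst) => [[a v] _ /=|]; last exact: measurable_fst.
by rewrite /rV_coor mxE unlift_none.
Qed.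

Let measurable_rV_uncons : measurable_fun setT rV_uncons.
Proof.
apply/measurable_fun_pair => /=; first exact: (measurable_rV_coor ord0).
apply: measurable_fun_rV => i.
apply: (eq_measurable_fun (rV_coor (lift ord0 i))) => [x _ /=|].
  by rewrite /rV_coor mxE.
exact: measurable_rV_coor.
Qed.

HB.instance Definition _ := isMeasurableFun.Build _ _ _ _ rV_cons
  measurable_rV_cons.

Definition lebesgue_rV_succ : set 'rV[R]_d.+1 -> \bar R :=
  pushforward (lebesgue_measure \x m)%E rV_cons.

Let lebesgue_rV_succ0 : lebesgue_rV_succ set0 = 0%E.
Proof. exact: measure0. Qed.

Let lebesgue_rV_succ_ge0 A : (0 <= lebesgue_rV_succ A)%E.
Proof. exact: measure_ge0. Qed.

Let lebesgue_rV_succ_sigma_additive : semi_sigma_additive lebesgue_rV_succ.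
Proof. exact: measure_semi_sigma_additive. Qed.

HB.instance Definition _ := isMeasure.Build _ _ _ lebesgue_rV_succ
  lebesgue_rV_succ0 lebesgue_rV_succ_ge0 lebesgue_rV_succ_sigma_additive.

Let lebesgue_rV_succ_sigma_finite : sigma_finite setT lebesgue_rV_succ.
Proof.
have [F FT Foo] := sigma_finite_product_measure1 lebesgue_measure m.
exists (fun n => rV_uncons @^-1` F n) => [|n].
  by rewrite -preimage_bigcup -FT preimage_setT.
have [mF Fn] := Foo n; split.
  by rewrite -[X in measurable X]setTI; exact: measurable_rV_uncons.
rewrite /lebesgue_rV_succ /pushforward -comp_preimage.
by rewrite (_ : _ \o _ = id)//; apply/funext => p; exact: rV_consK.
Qed.

HB.instance Definition _ := Measure_isSigmaFinite.Build _ _ _ lebesgue_rV_succ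
  lebesgue_rV_succ_sigma_finite.

End lebesgue_rV_succ.

Fixpoint lebesgue_rV (R : realType) (d : nat) :
    {sigma_finite_measure set 'rV[R]_d -> \bar R} :=
  if d is d'.+1 then lebesgue_rV_succ (lebesgue_rV R d')
  else \d_(0 : 'rV[R]_0).

Lemma lebesgue_rV_box (R : realType) (d : nat) (A : 'I_d -> set R) :
  (forall i, measurable (A i)) ->
  lebesgue_rV R d [set x | forall i, A i (x ord0 i)] =
  (\prod_(i < d) lebesgue_measure (A i))%E.
Proof.
elim: d A => [|d IHd] A mA.
  by rewrite big_ord0 /= diracE mem_set// => -[].
have mB : measurable [set x : 'rV[R]_d | forall i, A (lift ord0 i) (x ord0 i)].
  rewrite (_ : mkset _ =
      \bigcap_(i in [set: 'I_d]) (rV_coor i @^-1` A (lift ord0 i))).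
    apply: fin_bigcap_measurable => // i _.
    rewrite -[X in measurable X]setTI.
    exact: measurable_rV_coor.
  by apply/seteqP; split=> x /= Ax i; [move=> _; exact: Ax|exact: Ax].
rewrite big_ord_recl/= -IHd; last by move=> i; exact: mA.
rewrite /lebesgue_rV_succ /pushforward -product_measure1E//=; last exact: mA.
congr (_ _); apply/seteqP; split=> -[a v] /=.
  move=> Av; split=> [|i]; first by have := Av ord0; rewrite mxE unlift_none.
  by have := Av (lift ord0 i); rewrite mxE liftK.
move=> [Aa Av] i; rewrite mxE.
by case: (unliftP ord0 i) => [j|] ->.
Qed.

Section metric_curves.
Context (R : realType) (X : Type) (dist : X -> X -> R).
Implicit Types (p : \bar R) (i : interval R) (gamma : R -> X) (Y : set X).

(** Curves defined on an interval are total functions on [R], of which only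
    the values on that interval are used. *)

Definition abs_continuous p i gamma : Prop :=
  exists2 m : R -> R, m \_ [set` i] \in Lfun lebesgue_measure p &
    forall s t, s \in i -> t \in i -> s < t ->
      ((dist (gamma s) (gamma t))%:E <=
       \int[lebesgue_measure]_(u in `[s, t]) (m u)%:E)%E.

(** Only intervals bounded away from 0 are considered: an EVI flow started at a
    point of infinite energy has infinite kinetic energy on (0, b]. *)
Definition abs_continuous2_loc gamma : Prop :=
  forall a b : R, 0 < a -> a < b -> abs_continuous 2%:E `[a, b] gamma.

Definition metric_derivative i gamma (t : R) : \bar R :=
  limf_esup (fun s => (dist (gamma s) (gamma t) / `|s - t|)%:E)
    (within [set` i] t^').

Definition curve_length gamma : \bar R :=
  (\int[lebesgue_measure]_(t in `[0%R, 1%R])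
     metric_derivative `[0%R, 1%R] gamma t)%E.

Definition induced_length_dist Y (y y' : X) : \bar R :=
  ereal_inf [set curve_length gamma | gamma in
    [set gamma | [/\ abs_continuous 1%:E `[0, 1] gamma,
                     forall t, t \in `[0, 1] -> Y (gamma t),
                     gamma 0 = y & gamma 1 = y']]].

Definition upper_right_derivative (f : R -> R) (t : R) : \bar R :=
  limf_esup (fun h => ((f (t + h) - f t) / h)%:E) 0^'+.

Definition domain (E : X -> \bar R) : set X := [set x | (E x < +oo)%E].

Definition dist_closure Y : set X :=
  [set x | forall e, 0 < e -> exists2 y, Y y & dist y x < e].

Definition EVI_flow (lambda : R) (E : X -> \bar R) gamma : Prop :=
  [/\ abs_continuous2_loc gamma,
      (forall t, 0 < t -> E (gamma t) \is a fin_num),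
      (forall t (a : R), 0 < t -> (a%:E < E (gamma t))%E ->
        \forall s \near t, (a%:E < E (gamma s))%E) &
      forall x t, domain E x -> 0 < t ->
        ((2^-1)%:E *
           upper_right_derivative (fun s => (dist (gamma s) x ^+ 2)%R) t +
         (lambda / 2 * dist (gamma t) x ^+ 2)%:E <= E x - E (gamma t))%E].

(** [x] may be any point of the closure of the domain, with [E x = +oo]
    allowed. *)
Definition starts_from (E : X -> \bar R) gamma (x : X) : Prop :=
  dist (gamma t) x @[t --> 0^'+] --> 0 /\
  (E x <= limf_einf (E \o gamma) 0^'+)%E.

End metric_curves.

Section wasserstein.
Context (R : realType) (d : nat).

(** Squared Euclidean norm; the library norm on ['rV[R]_d] is the sup norm. *)
Definition sqnorm2 (x : 'rV[R]_d) : R := \sum_(i < d) x ord0 i ^+ 2.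

Record P2 := MkP2 {
  P2_measure :> probability 'rV[R]_d R;
  P2_moment : (\int[P2_measure]_x (sqnorm2 x)%:E < +oo)%E }.

Definition coupling (mu nu : P2) (pi : probability ('rV[R]_d * 'rV[R]_d)%type R)
  : Prop :=
  forall A : set 'rV[R]_d, measurable A ->
    pi (fst @^-1` A) = mu A /\ pi (snd @^-1` A) = nu A.

(** The infimum is finite because of the second moments. *)
Definition W2 (mu nu : P2) : R :=
  Num.sqrt (fine (ereal_inf
    [set (\int[pi]_p (sqnorm2 (p.1 - p.2))%:E)%E | pi in coupling mu nu])).

Definition is_density (rho : P2) (f : 'rV[R]_d -> R) : Prop :=
  [/\ measurable_fun setT f, forall x, 0 <= f x &
      forall A, measurable A -> rho A = (\int[lebesgue_rV R d]_(x in A) (f x)%:E)%E].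

(** [ln 0 = 0], so that 0 log 0 = 0. The value does not depend on the chosen
    density, and finite second moments make the negative part of [f * ln f]
    integrable. *)
Definition entropy (rho : P2) : \bar R :=
  if pselect (exists f, is_density rho f) is left h
  then (\int[lebesgue_rV R d]_x (projT1 (cid h) x * ln (projT1 (cid h) x))%:E)%E
  else +oo%E.

Definition free_energy (V : 'rV[R]_d -> R) (rho : P2) : \bar R :=
  (entropy rho + \int[rho]_x (V x)%:E)%E.

Definition lambda_convex (lambda : R) (V : 'rV[R]_d -> R) : Prop :=
  convex_function [set: convex_lmodType 'rV[R]_d]
    (fun x => V x - lambda / 2 * sqnorm2 x).

Definition partial (i : 'I_d) (V : 'rV[R]_d -> R) : 'rV[R]_d -> R :=
  'D_(delta_mx ord0 i) V.

Definition bounded_second_derivatives (V : 'rV[R]_d -> R) : Prop :=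
  [/\ forall x, differentiable V x,
      forall i x, differentiable (partial i V) x &
      exists C : R, forall i j x, `|partial j (partial i V) x| <= C].

End wasserstein.

(* Main.v *)
(** Every [y] in [Y] is joined to the minimiser [x0] of [E] by its flow [g].

    For small times, let [z] be the measure obtained by averaging [y] over the
    cells of a grid of side [r]. Its density is at most [r^-d], so
    [E z <= d ln (1 / r) + C], while [W2 y z <= C r]; in particular every [y] is
    in the closure of the domain of [E]. The integrated EVI with [r = sqrt t]
    gives [E (g t) <= C (1 + ln (1 / t))]. Two flows starting from points of the
    same trajectory contract, so the distances [dist (g t) (g (t + h))] decrease in
    [t], and the inequality
    [dist (g s) (g t) ^ 2 <= 2 (t - s) (E (g s) - E (g t))], summed over steps of
    length [h], bounds the speed at time [t] by
    [sqrt ((E (g (t / 2)) - E x0) / t)] up to a constant. This is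
    [O (t^-(3/4))] near [0], hence integrable. As [lambda > 0], the distance to
    [x0] decays fast enough for the speed to be [O (t^-2)] at infinity.
    Reparametrising by [t = s ^ 4] near [0] and [t = 1 / s] near infinity yields
    Lipschitz curves. *)
Require Import Defs.
From HB Require Import structures.
From mathcomp Require Import all_boot all_order all_algebra.
From mathcomp Require Import all_classical all_reals all_analysis.
From mathcomp Require Import measurable_realfun.
From mathcomp Require Import ring lra.

Set Implicit Arguments.
Unset Strict Implicit.
Unset Printing Implicit Defensive.

Import Order.TTheory GRing.Theory Num.Theory.
Import numFieldNormedType.Exports.

Local Open Scope classical_set_scope.
Local Open Scope ring_scope.

(** * Abstract EVI flows *)

(** Simple functions below the positive part of [f] on [D] also lie below [g]. This form suits
    integrands such as the metric derivative, whose measurability is not established. *)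
Lemma le_integral_nonmeasurable d (T : measurableType d) (R : realType)
    (mu : {measure set T -> \bar R}) (D : set T) (f g : T -> \bar R) :
  (forall x, D x -> (0 <= g x)%E) -> (forall x, D x -> (f x <= g x)%E) ->
  (\int[mu]_(x in D) f x <= \int[mu]_(x in D) g x)%E.
Proof.
move=> g0 fg; rewrite [leLHS]integralE.
apply: (@le_trans _ _ (\int[mu]_(x in D) (f^\+)%E x)%E).
  by rewrite -[leRHS]sube0 leeB ?integral_ge0.
rewrite !ge0_integralE//.
apply: le_ereal_sup => _ [h hf <-]; exists h => // x.
apply: le_trans (hf x) _; rewrite /patch; case: ifPn => // /[!inE] Dx.
by rewrite funeposE ge_max fg//= g0.
Qed.

(** * Growth bounds from one-sided derivatives and increments *)

Section dini.
Context (R : realType).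
Implicit Types (f : R -> R) (a b K t : R).

Lemma limf_esup_right_lt (F : R -> R) t K e : 0 < e ->
  (limf_esup (fun h => (F h)%:E) t^'+ <= K%:E)%E ->
  \forall h \near t^'+, F h < K + e.
Proof.
move=> e0 FK.
have : (limf_esup (fun h => (F h)%:E) t^'+ < (K + e)%:E)%E.
  by apply: le_lt_trans FK _; rewrite lte_fin ltrDl.
move=> /ereal_inf_lt[_ [W tW <-]] supW.
apply: filterS tW => h Wh; rewrite -lte_fin.
by apply: le_lt_trans supW; apply: ereal_sup_ubound; exists h.
Qed.

(** Continuation argument: the supremum of the times satisfying the growth bound with the larger
    slope [K + e1] satisfies it too, by left continuity. If it were less than [b], the bound on the
    derivative there would produce a later such time. *)
Lemma upper_right_derivative_le f a b K : a <= b ->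
  (forall t, a < t <= b -> f s @[s --> t^'-] --> f t) ->
  (forall t, a <= t < b -> (upper_right_derivative f t <= K%:E)%E) ->
  f b - f a <= K * (b - a).
Proof.
move=> ab fc fK; apply/ler_addgt0Pr => e e0.
have [->|ba] := eqVneq b a; first by rewrite !subrr mulr0 add0r ltW.
have {}ab : a < b by rewrite lt_neqAle eq_sym ba.
pose e1 := e / (b - a).
have e10 : 0 < e1 by rewrite divr_gt0// subr_gt0.
pose S := [set t | a <= t <= b /\ f t - f a <= (K + e1) * (t - a)].
have Sa : S a by split; rewrite ?lexx ?(ltW ab)// !subrr mulr0.
have ubS : ubound S b by move=> t [/andP[]].
have supS : has_sup S by split; [exists a|exists b].
have as_ : a <= sup S by exact: ub_le_sup supS.2 _ Sa.
have sb : sup S <= b by exact: ge_sup supS.1 ubS.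
have Ss : S (sup S).
  have [sE|sa] := eqVneq (sup S) a; first by rewrite sE.
  split; first by rewrite as_ sb.
  have {}sa : a < sup S by rewrite lt_neqAle eq_sym sa.
  apply/ler_addgt0Pr => h h0.
  have h40 : 0 < h / 4 by lra.
  have fs : \forall s \near (sup S)^'-, `|f (sup S) - f s| < h / 4.
    by move/cvgrPdist_lt: (fc (sup S) ltac:(by rewrite sa sb)); exact.
  have ls : \forall s \near (sup S)^'-, `|(K + e1) * (sup S - s)| < h / 4.
    have : (K + e1) * (sup S - s) @[s --> (sup S)^'-] --> (K + e1) * (sup S - sup S).
      by apply: cvgMr; apply: cvgB; [exact: cvg_cst|exact: cvg_at_left_filter].
    rewrite subrr mulr0 => /cvgr0Pnorm_lt; exact.
  have /= [n /= n0 nP] := filterI fs ls.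
  have [s Ss sn] := sup_adherent n0 supS.
  have : s <= sup S by exact: ub_le_sup supS.2 _ Ss.
  rewrite le_eqVlt => /predU1P[<-|ss]; first by have := Ss.2; lra.
  have [] := nP s _ ss; first by rewrite /= gtr0_norm ?subr_gt0//; lra.
  rewrite ltr_norml => /andP[_ h1]; rewrite ltr_norml => /andP[h2 _].
  have := Ss.2; nra.
have [sb'|sb'] := eqVneq (sup S) b.
  move: Ss; rewrite sb' => -[_ Sb].
  by apply: le_trans Sb _; rewrite mulrDl lerD2l divfK// subr_eq0.
have {}sb' : sup S < b by rewrite lt_neqAle sb'.
have := fK (sup S); rewrite as_ sb' => /(_ isT) /(limf_esup_right_lt e10) fs.
have : \forall h \near 0^'+, 0 < h < b - sup S.
  by near=> h; apply/andP; split=> //; near: h; apply: nbhs_right_lt; rewrite subr_gt0.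
move=> /(filterI fs) fsb; 
have [h [fh /andP[h0 hb]]] := @filter_ex _ _ (at_right_proper_filter 0) _ fsb.
rewrite ltr_pdivrMr// in fh.
have : S (sup S + h).
  split; first by apply/andP; split; lra.
  by have := Ss.2; nra.
by move=> /(ub_le_sup supS.2); rewrite gerDl leNgt h0.
Unshelve. all: end_near.
Qed.

(* Telescoping over [n.+1] equal steps leaves an error of order [1 / n]. *)
Lemma le_of_increment (G phi : R -> R) a b : a <= b ->
  (forall s t, a <= s -> s <= t -> t <= b ->
    G t - G s <= 2 * (t - s) * (phi s - phi t)) ->
  G b <= G a.
Proof.
move=> ab Gphi; rewrite leNgt; apply/negP => Gab.
pose M := 2 * (b - a) * (phi a - phi b).
(* Enough steps for the telescoped bound [M / n.+1] to fall below the supposed increase of [G]. *)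
pose n := Num.truncn (M / (G b - G a)).
have nP : M < n.+1%:R * (G b - G a).
  by rewrite -ltr_pdivrMr ?subr_gt0// truncnS_gt.
pose h := (b - a) / n.+1%:R.
have h0 : 0 <= h by rewrite divr_ge0// subr_ge0.
have hE : h * n.+1%:R = b - a by rewrite divfK// pnatr_eq0.
have step k : (k <= n.+1)%N ->
    G (a + k%:R * h) - G a <= 2 * h * (phi a - phi (a + k%:R * h)).
  elim: k => [|k IH] kn; first by rewrite mul0r addr0 !subrr mulr0.
  have := IH (ltnW kn); have kh0 : 0 <= k%:R * h by rewrite mulr_ge0.
  have khb : k.+1%:R * h <= b - a.
    by rewrite -hE [leRHS]mulrC ler_wpM2r// ler_nat.
  have := Gphi (a + k%:R * h) (a + k.+1%:R * h).
  rewrite -natr1 mulrDl mul1r in khb *.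
  have -> : a + (k%:R * h + h) - (a + k%:R * h) = h by ring.
  by move=> /(_ ltac:(lra) ltac:(lra) ltac:(lra)); lra.
have := step n.+1 (leqnn _).
have -> : a + n.+1%:R * h = b by rewrite mulrC hE addrC subrK.
have n0 : 0 < n.+1%:R :> R by rewrite ltr0n.
move: nP; rewrite /M -hE; nra.
Qed.

End dini.

(** * Lipschitz curves in [Y] and their length *)

Definition lipschitz_connected (R : realType) (X : Type) (dist : X -> X -> R)
    (Y : set X) (y y' : X) : Prop :=
  exists (K : R) (gamma : R -> X),
    [/\ forall s t, 0 <= s -> s <= t -> t <= 1 ->
          dist (gamma s) (gamma t) <= K * (t - s),
        forall t, 0 <= t -> t <= 1 -> Y (gamma t), gamma 0 = y & gamma 1 = y'].

Section lipschitz_connected.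
Context (R : realType) (X : Type) (dist : X -> X -> R).
Context (dist_ge0 : forall x y, 0 <= dist x y).
Context (distC : forall x y, dist x y = dist y x).
Context (dist_triangle : forall x y z, dist x z <= dist x y + dist y z).
Context (Y : set X).
Implicit Types (x y z : X) (s t K : R).

Lemma lipschitz_connected_sym y z :
  lipschitz_connected dist Y y z -> lipschitz_connected dist Y z y.
Proof.
move=> [K [c [cK Yc c0 c1]]]; exists K, (fun t => c (1 - t)); split.
- move=> s t s0 st t1; rewrite distC.
  have -> : t - s = 1 - s - (1 - t) by ring.
  by apply: cK; lra.
- by move=> t t0 t1; apply: Yc; lra.
- by rewrite subr0.
- by rewrite subrr.
Qed.

Lemma lipschitz_connected_trans x y z : lipschitz_connected dist Y x y ->
  lipschitz_connected dist Y y z -> lipschitz_connected dist Y x z.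
Proof.
move=> [K [c [cK Yc c0 c1]]] [L [b [bL Yb b0 b1]]].
exists (2 * K + 2 * L), (fun t => if t <= 2^-1 then c (2 * t) else b (2 * t - 1)).
have K0 : 0 <= K.
  by have := cK 0 1 (lexx _) ler01 (lexx _); have := dist_ge0 (c 0) (c 1); lra.
have L0 : 0 <= L.
  by have := bL 0 1 (lexx _) ler01 (lexx _); have := dist_ge0 (b 0) (b 1); lra.
split.
- move=> s t s0 st t1; case: (leP t) => t2; case: (leP s) => s2; try lra.
  + have := cK (2 * s) (2 * t) ltac:(lra) ltac:(lra) ltac:(lra); nra.
  + have := cK (2 * s) 1 ltac:(lra) ltac:(lra) ltac:(lra).
    have := bL 0 (2 * t - 1) ltac:(lra) ltac:(lra) ltac:(lra).
    rewrite c1 b0; have := dist_triangle (c (2 * s)) y (b (2 * t - 1)); nra.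
  + have := bL (2 * s - 1) (2 * t - 1) ltac:(lra) ltac:(lra) ltac:(lra); nra.
- by move=> t t0 t1; case: leP => t2; [apply: Yc|apply: Yb]; lra.
- by rewrite invr_ge0 ler0n mulr0.
- by rewrite leNgt invf_lt1 ?ltr1n//= mulr1 -b1; congr b; ring.
Qed.

(** The speed estimates for the flows compare only times within a factor 2. Chaining them along [r],
    [2 * r], [4 * r], ... up to [t] loses nothing in the constant, and letting [r] tend to 0 reaches
    the endpoint 0. *)
Lemma lipschitz_of_dyadic (c : R -> X) K :
  (forall s t, 0 < s -> s < t -> t <= 2 * s -> t <= 1 ->
    dist (c s) (c t) <= K * (t - s)) ->
  dist (c s) (c 0) @[s --> 0^'+] --> 0 -> dist (c 0) (c 0) = 0 ->
  forall s t, 0 <= s -> s < t -> t <= 1 -> dist (c s) (c t) <= K * (t - s).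
Proof.
move=> cK c0 c00 s t s0 st t1.
have pos r : 0 < r -> r < t -> dist (c r) (c t) <= K * (t - r).
  move=> r0 rt.
  have [n nP] : exists n, t <= 2 ^+ n * r.
    exists (Num.truncn (r^-1)).+1.
    apply: (le_trans t1); rewrite -ler_pdivrMr// mul1r.
    apply: ltW; apply: lt_trans (truncnS_gt _) _.
    by rewrite -natrX ltr_nat ltn_expl.
  elim: n r r0 rt nP => [|n IH] r r0 rt; first by rewrite mul1r leNgt rt.
  rewrite exprSr -mulrA => nP.
  have [t2|t2] := leP t (2 * r); first exact: cK.
  have := IH (2 * r) ltac:(lra) t2 nP.
  have := cK r (2 * r) r0 ltac:(lra) (lexx _) ltac:(lra).
  have := dist_triangle (c r) (c (2 * r)) (c t); lra.
have [->|s0'] := eqVneq s 0; last by apply: pos => //; rewrite lt_neqAle eq_sym s0'.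
have t0 : 0 < t by lra.
have : dist (c r) (c 0) + K * (t - r) @[r --> 0^'+] --> 0 + K * (t - 0).
  apply: cvgD c0 _; apply: cvgMr; apply: cvgB; first exact: cvg_cst.
  exact: cvg_at_right_filter.
rewrite add0r => /(@cvgr_to_ge _ _ (at_right_proper_filter 0)); apply.
near=> r.
have r0 : 0 < r by near: r; exact: nbhs_right_gt.
have rt : r < t by near: r; exact: nbhs_right_lt.
have := pos r r0 rt; have := dist_triangle (c 0) (c r) (c t).
rewrite (distC (c 0) (c r)); lra.
Unshelve. all: end_near.
Qed.

(** The constant [K] serves as the integrable modulus and bounds the metric derivative at every
    time, so the length is at most [K]. *)
Lemma lipschitz_connected_length y z : lipschitz_connected dist Y y z ->
  (induced_length_dist dist Y y z < +oo)%E.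
Proof.
move=> [K [c [cK Yc c0 c1]]].
have K0 : 0 <= K.
  by have := cK 0 1 (lexx _) ler01 (lexx _); have := dist_ge0 (c 0) (c 1); lra.
apply: (@le_lt_trans _ _ (curve_length dist c)).
  apply: ereal_inf_lbound; exists c => //; split=> //.
    exists (cst K).
      apply/Lfun1_integrable.
      have := integrableZl (measurableT) K (integrable_indic_itv 0 1 true false).
      congr (_.-integrable _ _); apply/funext => t /=.
      by rewrite patchE indicE -EFinM /=; case: ifPn => _; rewrite ?mulr1 ?mulr0.
    move=> s t; rewrite !in_itv/= => /andP[s0 _] /andP[_ t1] st.
    rewrite integral_cst//= lebesgue_measure_itv/= lte_fin st -EFinB -EFinM lee_fin.
    exact: cK (ltW st) t1.
  by move=> t; rewrite in_itv/= => /andP[]; exact: Yc.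
apply: (@le_lt_trans _ _ (\int[lebesgue_measure]_(t in `[0%R, 1%R]) K%:E)%E).
  apply: le_integral_nonmeasurable => t /=; first by rewrite lee_fin.
  rewrite in_itv/= => /andP[t0 t1].
  (* The difference quotients are bounded by [K] on all of [0, 1], so the whole punctured interval
     can be taken as the neighbourhood in the limsup. *)
  pose W := [set s | s \in `[0, 1] /\ s != t].
  apply: (@le_trans _ _ (ereal_sup
      ((fun s => (dist (c s) (c t) / `|s - t|)%:E) @` W))).
    apply: ereal_inf_lbound; exists W => //.
    by exists 1 => //= s _ st s01; split.
  apply: ge_ereal_sup => _ [s /= [s01 st] <-]; rewrite in_itv/= in s01.
  case/andP: s01 => s0 s1; rewrite lee_fin ler_pdivrMr ?normr_gt0 ?subr_eq0//.
  have [{}st|{}st] := leP s t.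
    by rewrite distrC ger0_norm ?subr_ge0//; exact: cK.
  by rewrite gtr0_norm ?subr_gt0// distC; apply: cK => //; exact: ltW.
rewrite integral_cst//= lebesgue_measure_itv/= lte_fin ltr01 -EFinB -EFinM.
exact: ltry.
Qed.

End lipschitz_connected.

(** * Arithmetic of the speed bounds in reparametrised time *)

Section speed_at_infinity.
Context (R : realFieldType).
Implicit Types l D h T e f F K s t : R.

(** [D] stands for the length of a step [h] taken at time [T], [e] for the energy excess at [T / 2],
    and [f2], [f3], [f4] for the squared distances to the minimiser at [T / 4], [T / 8], [T / 16].
    Each of the four inequalities gains a factor [1 / T], so that [D / h] is of order [T^-2]. *)
Lemma speed_at_infinity l D h T e f2 f3 f4 : 0 < l -> 0 < T ->
  D ^+ 2 * (T - T / 2) <= 2 * h ^+ 2 * e -> e * (T / 2) <= f2 ->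
  l * (T / 2 / 2) * f2 <= 2 * f3 -> l * (T / 2 / 2 / 2) * f3 <= 2 * f4 ->
  l ^+ 2 * D ^+ 2 * T ^+ 4 <= 1024 * h ^+ 2 * f4.
Proof.
move=> l0 T0 De ef f23 f34.
have e5 : l ^+ 2 * T ^+ 2 * f2 <= 128 * f4.
  have : l * T * (l * (T / 2 / 2) * f2) <= l * T * (2 * f3).
    by apply: ler_wpM2l => //; rewrite mulr_ge0 ?ltW.
  clear -f34; lra.
have e6 : D ^+ 2 * T ^+ 2 <= 8 * (h ^+ 2 * f2).
  have : D ^+ 2 * (T - T / 2) * T <= 2 * h ^+ 2 * e * T by apply: ler_wpM2r => //; exact: ltW.
  have : h ^+ 2 * (e * (T / 2)) <= h ^+ 2 * f2 by apply: ler_wpM2l => //; exact: sqr_ge0.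
  clear; lra.
have -> : l ^+ 2 * D ^+ 2 * T ^+ 4 = l ^+ 2 * T ^+ 2 * (D ^+ 2 * T ^+ 2) by ring.
apply: (@le_trans _ _ (l ^+ 2 * T ^+ 2 * (8 * (h ^+ 2 * f2)))).
  by apply: ler_wpM2l => //; rewrite mulr_ge0 ?sqr_ge0.
have -> : l ^+ 2 * T ^+ 2 * (8 * (h ^+ 2 * f2)) = 8 * h ^+ 2 * (l ^+ 2 * T ^+ 2 * f2) by ring.
have -> : 1024 * h ^+ 2 * f4 = 8 * h ^+ 2 * (128 * f4) by ring.
by apply: ler_wpM2l e5; exact: mulr_ge0 (ler0n _ _) (sqr_ge0 _).
Qed.

(** With [T = 1 / t] and [h = 1 / s - 1 / t], the product of [h] and [T^-2] is
    [p = (t - s) * (t / s)], at most [2 * (t - s)] because [t <= 2 * s]. This factor 2, squared,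
    turns 1024 into 4096. *)
Lemma speed_inversion l D K F s t : 0 < l -> 0 <= K -> 0 <= F -> 0 <= D ->
  0 < s -> s < t -> t <= 2 * s -> 4096 * F <= l ^+ 2 * K ^+ 2 ->
  l ^+ 2 * D ^+ 2 * t^-1 ^+ 4 <= 1024 * (s^-1 - t^-1) ^+ 2 * F ->
  D <= K * (t - s).
Proof.
move=> l0 K0 F0 D0 s0 st ts FK lD; have t0 := lt_trans s0 st.
have ts0 : 0 <= t - s by rewrite subr_ge0 ltW.
have [p pE] : exists p, p = (t - s) * (t / s) by eexists.
have p0 : 0 <= p by rewrite pE mulr_ge0// divr_ge0// ltW.
have p2 : p ^+ 2 <= (2 * (t - s)) ^+ 2.
  rewrite ler_pXn2r ?nnegrE ?mulr_ge0// pE mulrC; apply: ler_wpM2r => //.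
  by rewrite ler_pdivrMr.
have {}lD : l ^+ 2 * D ^+ 2 <= 1024 * F * p ^+ 2.
  have -> : l ^+ 2 * D ^+ 2 = l ^+ 2 * D ^+ 2 * t^-1 ^+ 4 * t ^+ 4.
    by field; rewrite gt_eqF.
  have -> : 1024 * F * p ^+ 2 = 1024 * (s^-1 - t^-1) ^+ 2 * F * t ^+ 4.
    by rewrite pE; field; rewrite !gt_eqF.
  by apply: ler_wpM2r lD; exact: exprn_ge0 (ltW t0).
rewrite -(ler_pXn2r (n := 2))// ?nnegrE ?mulr_ge0//.
rewrite -(ler_pM2l (exprn_gt0 2 l0)); apply: (le_trans lD).
apply: (@le_trans _ _ (1024 * F * (2 * (t - s)) ^+ 2)).
  by apply: ler_wpM2l p2; exact: mulr_ge0 (ler0n _ _) F0.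
have -> : 1024 * F * (2 * (t - s)) ^+ 2 = 4096 * F * (t - s) ^+ 2 by ring.
by rewrite exprMn [leRHS]mulrA; apply: ler_wpM2r FK; exact: sqr_ge0.
Qed.

(** Here [e] is the energy excess at time [(s / 2) ^+ 4], of order [C / s]. As [t <= 2 * s], the
    time step [h] is at most [3 * 5 * s ^+ 3 * (t - s)]; dividing by [s ^+ 5] leaves
    [960 * C * s * (t - s) ^+ 2], where [960 = 2 * 15 ^+ 2 * 2 * 16 / 15]. *)
Lemma speed_at_zero D C K e s t : 0 <= C -> 0 <= D -> 0 <= K -> 960 * C <= K ^+ 2 ->
  0 < s -> s < t -> t <= 2 * s -> t <= 1 -> s / 2 * e <= C ->
  D ^+ 2 * (s ^+ 4 - (s / 2) ^+ 4) <= 2 * (t ^+ 4 - s ^+ 4) ^+ 2 * e ->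
  D <= K * (t - s).
Proof.
move=> C0 D0 K0 CK s0 st ts t1 eC De; have t0 := lt_trans s0 st.
have ts0 : 0 <= t - s by rewrite subr_ge0 ltW.
have [h hE] : exists h, h = t ^+ 4 - s ^+ 4 by eexists.
have h0 : 0 <= h by rewrite hE subr_ge0 ler_pXn2r ?nnegrE ?ltW.
have h15 : h <= 15 * s ^+ 3 * (t - s).
  have -> : h = (t + s) * (t ^+ 2 + s ^+ 2) * (t - s) by rewrite hE; ring.
  apply: ler_wpM2r => //.
  have -> : 15 * s ^+ 3 = (3 * s) * (5 * s ^+ 2) by ring.
  apply: ler_pM; [clear -s0 t0; lra|by rewrite addr_ge0 ?sqr_ge0|clear -ts; lra|].
  have : t ^+ 2 <= (2 * s) ^+ 2.
    by rewrite ler_pXn2r ?nnegrE ?(ltW t0)// mulr_ge0// ltW.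
  clear; lra.
have h2 : h ^+ 2 <= (15 * s ^+ 3 * (t - s)) ^+ 2.
  by rewrite ler_pXn2r ?nnegrE// (le_trans h0).
rewrite -hE in De.
have e1 : D ^+ 2 * s ^+ 5 <= (960 * C * s * (t - s) ^+ 2) * s ^+ 5.
  have : D ^+ 2 * (s ^+ 4 - (s / 2) ^+ 4) * (s / 2) <= 2 * h ^+ 2 * e * (s / 2).
    by apply: ler_wpM2r => //; rewrite divr_ge0 ?ltW.
  have : h ^+ 2 * (s / 2 * e) <= h ^+ 2 * C by apply: ler_wpM2l => //; exact: sqr_ge0.
  have : C * h ^+ 2 <= C * (15 * s ^+ 3 * (t - s)) ^+ 2 by apply: ler_wpM2l.
  clear; lra.
rewrite ler_pM2r ?exprn_gt0// in e1.
rewrite -(ler_pXn2r (n := 2))// ?nnegrE ?mulr_ge0//.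
apply: (le_trans e1); rewrite exprMn; apply: ler_wpM2r; first exact: sqr_ge0.
apply: le_trans CK; apply: ler_piMr; first exact: mulr_ge0 (ler0n _ _) C0.
exact: le_trans (ltW st) t1.
Qed.

End speed_at_infinity.

(** * Estimates along an EVI flow *)

Section evi.
Context (R : realType) (X : Type) (dist : X -> X -> R).
Context (dist_ge0 : forall x y, 0 <= dist x y) (distxx : forall x, dist x x = 0).
Context (distC : forall x y, dist x y = dist y x).
Context (dist_triangle : forall x y z, dist x z <= dist x y + dist y z).

(** Young's inequality [m <= k * m ^+ 2 + 1 / (4 * k)] is applied under the integral. The choice of
    [k] keeps the first term at most [e / 4], and an interval shorter than [2 * k * e] keeps the
    second below [e / 2]. *)
Lemma abs_continuous2_modulus (g : R -> X) (a b e : R) :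
  abs_continuous dist 2%:E `[a, b] g -> 0 < e ->
  exists2 h, 0 < h & forall s t, a <= s -> s < t -> t <= b -> t - s < h ->
    dist (g s) (g t) < e.
Proof.
move=> [m /Lfun2_integrable_sqr + gm] e0.
set f : R -> R := m \_ _ => f2.
pose M := fine (\int[lebesgue_measure]_u (f u ^+ 2)%:E).
have ME : (\int[lebesgue_measure]_u (f u ^+ 2)%:E = M%:E)%E.
  by rewrite fineK//; exact: integrable_fin_num f2.
have M0 : 0 <= M by apply: fine_ge0; apply: integral_ge0 => u _; rewrite lee_fin sqr_ge0.
have mf2 := measurable_int _ f2.
have [k k0 kE] : exists2 k : R, 0 < k & k * (4 * (M + 1)) = e.
  have M1 : 0 < 4 * (M + 1) by lra.
  by exists (e / (4 * (M + 1))); rewrite ?divr_gt0// divfK ?gt_eqF.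
have k1 : 0 < (4 * k)^-1 by rewrite invr_gt0 mulr_gt0.
exists (2 * k * e) => [|s t as_ st tb tsk]; first by rewrite mulr_gt0// mulr_gt0.
rewrite -lte_fin; apply: le_lt_trans (gm s t _ _ st) _.
- by rewrite in_itv/= as_ (le_trans (ltW st)).
- by rewrite in_itv/= tb (le_trans as_ (ltW st)).
apply: (@le_lt_trans _ _ (\int[lebesgue_measure]_(u in `[s, t])
    (k%:E * (f u ^+ 2)%:E + ((4 * k)^-1)%:E))%E).
  apply: le_integral_nonmeasurable => u /=; rewrite in_itv/= => /andP[su ut].
    by rewrite -EFinM -EFinD lee_fin addr_ge0 ?(ltW k1)// mulr_ge0 ?sqr_ge0// ltW.
  have -> : m u = f u.
    rewrite /f patchE mem_set//= in_itv/= (le_trans as_ su) (le_trans ut tb)//.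
  rewrite -EFinM -EFinD lee_fin -subr_ge0.
  have -> : k * f u ^+ 2 + (4 * k)^-1 - f u = k * (f u - (2 * k)^-1) ^+ 2.
    by field; rewrite gt_eqF.
  by rewrite mulr_ge0 ?sqr_ge0// ltW.
rewrite ge0_integralD//; last 3 first.
- by move=> u _; rewrite -EFinM lee_fin mulr_ge0 ?sqr_ge0// ltW.
- by apply: measurable_funeM; exact: measurable_funS mf2.
- by move=> u _; rewrite lee_fin ltW.
rewrite ge0_integralZl//; last 3 first.
- exact: measurable_funS mf2.
- by move=> u _; rewrite lee_fin sqr_ge0.
- by rewrite lee_fin ltW.
rewrite integral_cst//= lebesgue_measure_itv/= lte_fin st -EFinB -EFinM.
apply: (@le_lt_trans _ _ (k%:E * M%:E + ((4 * k)^-1 * (t - s))%:E)%E).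
  rewrite leeD2r// lee_pmul2l ?lte_fin// -ME; apply: ge0_subset_integral => //.
  by move=> u _; rewrite lee_fin sqr_ge0.
rewrite -EFinM -EFinD lte_fin.
have : k * M <= e / 4 by lra.
have : (4 * k)^-1 * (t - s) < e / 2.
  by rewrite mulrC ltr_pdivrMr ?mulr_gt0//; lra.
lra.
Qed.

Context (E : X -> \bar R).
Context (lambda : R) (lambda0 : 0 < lambda) (g : R -> X).
Context (gE : EVI_flow dist lambda E g).
Implicit Types (s t u h : R) (x : X).

Lemma EVI_flow_left_continuous x t : 0 < t ->
  (dist (g s) x) ^+ 2 @[s --> t^'-] --> dist (g t) x ^+ 2.
Proof.
move=> t0; apply: (@cvg_comp _ _ _ (fun s => dist (g s) x) (fun r => r ^+ 2)).
  2: exact: exprn_continuous.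
apply/cvgrPdist_lt => e e0.
have t2 : 0 < t / 2 by lra.
have t2t : t / 2 < t by lra.
have [h h0 hP] := abs_continuous2_modulus (let: And4 H _ _ _ := gE in H _ _ t2 t2t) e0.
near=> s.
have st : s < t by near: s; exact: nbhs_left_lt.
have t2s : t / 2 <= s by near: s; apply: nbhs_left_ge.
have ths : t - s < h.
  by rewrite ltrBlDr -ltrBlDl; near: s; apply: nbhs_left_gt; rewrite ltrBlDl ltrDr.
have := hP s t t2s st (lexx _) ths.
have := dist_triangle (g s) (g t) x.
have := dist_triangle (g t) (g s) x; rewrite (distC (g t) (g s)) ltr_norml; lra.
Unshelve. all: end_near.
Qed.

Lemma EVI_flow_fine t : 0 < t -> E (g t) = (fine (E (g t)))%:E.
Proof. by case: gE => _ + _ _ => /[apply] ?; rewrite fineK. Qed.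

Lemma EVI_flow_derivative x ex t : E x = ex%:E -> 0 < t ->
  (upper_right_derivative (fun s => (dist (g s) x ^+ 2)%R) t <=
   (2 * (ex - fine (E (g t))) - lambda * dist (g t) x ^+ 2)%:E)%E.
Proof.
move=> xE t0; case: gE => _ _ _ /(_ x t _ t0).
rewrite /domain/= xE ltry => /(_ isT); rewrite EVI_flow_fine//=.
case: upper_right_derivative => [r| |].
- by rewrite -EFinM -EFinD -EFinB !lee_fin; lra.
- by rewrite gt0_muley ?lte_fin// addye// -EFinB leye_eq.
- by rewrite leNye.
Qed.

(* The energy is not yet known to decrease, hence the pointwise lower bound. *)
Lemma EVI_flow_increment x ex s t m B : E x = ex%:E -> 0 < s -> s <= t ->
  (forall r, s <= r <= t -> m <= fine (E (g r)) /\ B <= dist (g r) x ^+ 2) ->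
  dist (g t) x ^+ 2 - dist (g s) x ^+ 2 <= (2 * (ex - m) - lambda * B) * (t - s).
Proof.
move=> xE s0 st mB.
apply: (@upper_right_derivative_le _ (fun r => dist (g r) x ^+ 2)) => // r /andP[sr rt].
  by apply: EVI_flow_left_continuous; exact: lt_trans sr.
apply: (le_trans (EVI_flow_derivative xE _)); first exact: lt_le_trans sr.
have [] := mB r; first by rewrite sr ltW.
by move=> mr Br; rewrite lee_fin; have := ltW lambda0; nra.
Qed.

(** Suppose the energy at [t] exceeds that at [s], and let [p] be the last time when it does not
    exceed it; lower semicontinuity shows that [p] is attained. After [p] the energy is above that
    of [g p], so the EVI with reference point [g p] keeps the flow at distance 0 from [g p], while
    the same EVI makes the derivative of this distance squared negative. *)
Lemma EVI_flow_energy_nonincreasing s t : 0 < s -> s <= t ->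
  fine (E (g t)) <= fine (E (g s)).
Proof.
move=> s0 st; rewrite leNgt; apply/negP => Est.
have {st}st : s < t.
  by move: st; rewrite le_eqVlt => /predU1P[stE|//]; rewrite stE ltxx in Est.
pose S := [set r | s <= r <= t /\ fine (E (g r)) <= fine (E (g s))].
have Ss : S s by split; rewrite ?lexx ?(ltW st).
have ubS : ubound S t by move=> r [/andP[]].
have supS : has_sup S by split; [exists s|exists t].
pose p := sup S.
have sp : s <= p by exact: ub_le_sup supS.2 _ Ss.
have pt : p <= t by exact: ge_sup supS.1 ubS.
have p0 : 0 < p by exact: lt_le_trans sp.
have Ep : fine (E (g p)) <= fine (E (g s)).
  rewrite leNgt; apply/negP => Esp.
  case: gE => _ _ /(_ p (fine (E (g s))) p0) + _.
  rewrite (EVI_flow_fine p0) lte_fin => /(_ Esp) [n /= n0 nP].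
  have [r Sr pr] := sup_adherent n0 supS.
  have rp : r <= p by exact: ub_le_sup supS.2 _ Sr.
  have := nP r; rewrite /= ger0_norm ?subr_ge0// -/p in pr *.
  rewrite ltrBlDr -ltrBlDl => /(_ pr).
  case: Sr => /andP[sr _] Er; rewrite (@EVI_flow_fine r); last exact: lt_le_trans sr.
  by rewrite lte_fin ltNge Er.
have Epr r : p < r -> r <= t -> fine (E (g s)) < fine (E (g r)).
  move=> pr rt; rewrite ltNge; apply/negP => Er.
  have /(ub_le_sup supS.2) : S r by split=> //; rewrite rt (ltW (le_lt_trans sp pr)).
  by rewrite leNgt pr.
have {}pt : p < t.
  by rewrite lt_neqAle pt andbT; apply/eqP => ptE; move: Ep; rewrite ptE leNgt Est.
have gp r : p <= r -> r <= t -> dist (g r) (g p) ^+ 2 = 0.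
  move=> pr rt; apply/eqP; rewrite eq_le sqr_ge0 andbT.
  have := @EVI_flow_increment (g p) _ p r (fine (E (g p))) 0 (EVI_flow_fine p0) p0 pr.
  rewrite distxx expr0n/= !subrr subr0 mulr0 mulr0 subrr mul0r; apply.
  move=> q /andP[pq qr]; rewrite sqr_ge0; split=> //.
  move: pq; rewrite le_eqVlt => /predU1P[->//|pq].
  by rewrite (le_trans Ep)// ltW// Epr// (le_trans qr).
have [q pq qt] : exists2 q, p < q & q < t by exists ((p + t) / 2); lra.
have q0 := lt_trans p0 pq.
have := EVI_flow_derivative (EVI_flow_fine p0) q0.
rewrite gp ?(ltW pq) ?(ltW qt)// mulr0 subr0 leNgt => /negP; apply.
apply: (@lt_le_trans _ _ 0%:E).
  by rewrite lte_fin; have := Epr _ pq (ltW qt); lra.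
(* Just after [q] the distance to [g p] is still 0, so the difference quotients vanish there and the
   limsup is at least 0. *)
apply: le_ereal_inf_tmp => _ [W W0 <-].
have W0' : \forall h \near 0^'+, [/\ W h, 0 < h & h < t - q].
  by near=> h; split=> //; near: h => //; apply: nbhs_right_lt; rewrite subr_gt0.
have [h [Wh h0 hqt]] := @filter_ex _ _ (at_right_proper_filter 0) _ W0'.
apply: ereal_sup_ubound; exists h => //=.
by rewrite !gp ?subrr ?mul0r//; lra.
Unshelve. all: end_near.
Qed.

(** Integrated EVI: by monotonicity the energy on [[s, t]] is at least its value at [t], and the
    [lambda] term is dropped. *)
Lemma EVI_flow_increment_sqr x ex s t : E x = ex%:E -> 0 < s -> s <= t ->
  dist (g t) x ^+ 2 - dist (g s) x ^+ 2 <= 2 * (t - s) * (ex - fine (E (g t))).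
Proof.
move=> xE s0 st.
have := @EVI_flow_increment x ex s t (fine (E (g t))) 0 xE s0 st.
rewrite mulr0 subr0 mulrAC; apply=> r /andP[sr rt]; rewrite sqr_ge0; split=> //.
by apply: EVI_flow_energy_nonincreasing => //; exact: lt_le_trans sr.
Qed.

Lemma EVI_flow_dist_sqr s t : 0 < s -> s <= t ->
  dist (g s) (g t) ^+ 2 <= 2 * (t - s) * (fine (E (g s)) - fine (E (g t))).
Proof.
move=> s0 st; have := EVI_flow_increment_sqr (EVI_flow_fine s0) s0 st.
by rewrite distxx expr0n/= subr0 distC.
Qed.

(** To move the pair from times [(r, r + h)] to [(q, q + h)], the first point moves with [g (q + h)]
    as reference, then the second with [g r]. The energies of [g (q + h)] cancel in the sum, and
    what remains is the increment bound of [le_of_increment] with the energy as [phi]. *)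
Lemma EVI_flow_step_nonincreasing h s t : 0 < h -> 0 < s -> s <= t ->
  dist (g t) (g (t + h)) ^+ 2 <= dist (g s) (g (s + h)) ^+ 2.
Proof.
move=> h0 s0 st.
apply: (@le_of_increment _ (fun r => dist (g r) (g (r + h)) ^+ 2)
  (fun r => fine (E (g r)))) => // r q sr rq _.
have r0 : 0 < r by lra.
have h1 := EVI_flow_increment_sqr (EVI_flow_fine (t := q + h) ltac:(lra)) r0 rq.
have := @EVI_flow_increment_sqr _ _ (r + h) (q + h) (EVI_flow_fine r0)
  ltac:(lra) ltac:(lra).
rewrite !(distC _ (g r)); have -> : q + h - (r + h) = q - r by ring.
lra.
Qed.

Context (m : R) (mE : forall t, 0 < t -> m <= fine (E (g t))).

(* Steps of size [h] taken on [[u, t]] are at least as long as the one at [t],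
   and the sum of their squares is controlled by the energy drop. *)
Lemma EVI_flow_speed u t h : 0 < u -> u < t -> 0 < h ->
  dist (g t) (g (t + h)) ^+ 2 * (t - u) <= 2 * h ^+ 2 * (fine (E (g u)) - m).
Proof.
move=> u0 ut h0; set D := dist _ _ ^+ 2.
have D0 : 0 <= D by exact: sqr_ge0.
(* The slack [h] on the right lets the last step end after [t]: it only has to start no later than
   [t] to be at least as long as the step at [t]. *)
have step n : n%:R * h <= t - u + h ->
    n%:R * D <= 2 * h * (fine (E (g u)) - fine (E (g (u + n%:R * h)))).
  elim: n => [|n IH]; first by rewrite !mul0r addr0 subrr mulr0.
  rewrite -natr1 !mulrDl !mul1r => nh; have {}IH := IH ltac:(lra).
  have nh0 : 0 <= n%:R * h by rewrite mulr_ge0// ltW.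
  have DD : D <= dist (g (u + n%:R * h)) (g (u + n%:R * h + h)) ^+ 2.
    by apply: EVI_flow_step_nonincreasing => //; lra.
  have := @EVI_flow_dist_sqr (u + n%:R * h) (u + n%:R * h + h) ltac:(lra) ltac:(lra).
  rewrite [_ + h - _]addrAC subrr add0r -addrA in DD *; lra.
(* [k] full steps fit between [u] and [t], so [k.+1] steps cover more than [t - u] and are still
   allowed. *)
pose k := Num.truncn ((t - u) / h).
have /andP[kh hk] : k%:R <= (t - u) / h < k.+1%:R.
  by apply: truncn_itv; rewrite divr_ge0 ?(ltW h0)//; lra.
rewrite ler_pdivlMr// in kh; rewrite ltr_pdivrMr// in hk.
have := step k.+1; rewrite -natr1 mulrDl mul1r lerD2r => /(_ kh).
rewrite -natr1 mulrDl mul1r in hk.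
have := @mE (u + (k%:R * h + h)) ltac:(lra).
by nra.
Qed.

(** The integrated EVI on [[s, t]] with [s] tending to 0. Only the comparison point [x] has to have
    finite energy, so that a starting point [y] of infinite energy is covered. *)
Lemma EVI_flow_energy_le y x ex t : E x = ex%:E -> 0 < t ->
  dist (g s) y @[s --> 0^'+] --> 0 ->
  2 * t * (fine (E (g t)) - ex) <= dist y x ^+ 2.
Proof.
move=> xE t0 gy; rewrite -subr_ge0.
pose F s := (dist (g s) y + dist y x) ^+ 2 - 2 * (t - s) * (fine (E (g t)) - ex).
have : F s @[s --> 0^'+] --> (0 + dist y x) ^+ 2 - 2 * (t - 0) * (fine (E (g t)) - ex).
  apply: cvgB.
    apply: (@cvg_comp _ _ _ (fun s => dist (g s) y + dist y x) (fun r => r ^+ 2)).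
      by apply: cvgD gy _; exact: cvg_cst.
    exact: exprn_continuous.
  apply: cvgMl; apply: cvgMr; apply: cvgB; first exact: cvg_cst.
  exact: cvg_at_right_filter.
rewrite add0r subr0 => /(@cvgr_to_ge _ _ (at_right_proper_filter 0)); apply.
near=> s.
have s0 : 0 < s by near: s; exact: nbhs_right_gt.
have st : s < t by near: s; exact: nbhs_right_lt.
have := EVI_flow_increment_sqr xE s0 (ltW st).
have := dist_triangle (g s) y x.
have := dist_ge0 (g s) x; have := sqr_ge0 (dist (g t) x).
by rewrite /F; nra.
Unshelve. all: end_near.
Qed.

Context (x0 : X) (x0E : E x0 = m%:E).

Lemma EVI_flow_dist_min_nonincreasing s t : 0 < s -> s <= t ->
  dist (g t) x0 ^+ 2 <= dist (g s) x0 ^+ 2.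
Proof.
move=> s0 st; rewrite -subr_le0.
apply: le_trans (EVI_flow_increment_sqr x0E s0 st) _.
by have := @mE t ltac:(lra); nra.
Qed.

(** Against the minimiser the energy terms have a favourable sign, and on [[t / 2, t]] the [lambda]
    term is at least its value at [t]. Iterating this gives the polynomial decay used at
    infinity. *)
Lemma EVI_flow_dist_min_halve t : 0 < t ->
  lambda * t * dist (g t) x0 ^+ 2 <= 2 * dist (g (t / 2)) x0 ^+ 2.
Proof.
move=> t0.
have : dist (g t) x0 ^+ 2 - dist (g (t / 2)) x0 ^+ 2 <=
    (2 * (m - m) - lambda * dist (g t) x0 ^+ 2) * (t - t / 2).
  apply: EVI_flow_increment => // [||r /andP[tr rt]]; [lra|lra|].
  by split; [apply: mE|apply: EVI_flow_dist_min_nonincreasing]; lra.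
have := sqr_ge0 (dist (g t) x0); lra.
Qed.

Lemma EVI_flow_energy_dist_min t : 0 < t ->
  (fine (E (g t)) - m) * t <= dist (g (t / 2)) x0 ^+ 2.
Proof.
move=> t0; have := @EVI_flow_increment_sqr x0 m (t / 2) t x0E ltac:(lra) ltac:(lra).
have := sqr_ge0 (dist (g t) x0); lra.
Qed.

Lemma EVI_flow_connected_min Y : (forall t, 0 < t -> Y (g t)) -> Y x0 ->
  lipschitz_connected dist Y x0 (g 1).
Proof.
move=> gY Yx0.
pose f t := dist (g t) x0 ^+ 2.
have f0 t : 0 <= f t by exact: sqr_ge0.
have fmono s t : 0 < s -> s <= t -> f t <= f s.
  exact: EVI_flow_dist_min_nonincreasing.
pose c s := if 0 < s then g (s^-1) else x0.
have c0 : c 0 = x0 by rewrite /c ltxx.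
(* The speed at time [T = 1 / t >= 1] is bounded through the distance to [x0] at [T / 16], which is
   at most the distance at [1 / 16]. *)
have [K K0 KE] : exists2 K, 0 <= K & 4096 * f (1 / 16) <= lambda ^+ 2 * K ^+ 2.
  exists (64 * dist (g (1 / 16)) x0 / lambda).
    by rewrite divr_ge0 ?(ltW lambda0)// mulr_ge0.
  rewrite [leRHS](_ : _ = 4096 * f (1 / 16))// /f.
  by field; rewrite gt_eqF.
have cK s t : 0 < s -> s < t -> t <= 2 * s -> t <= 1 -> dist (c s) (c t) <= K * (t - s).
  move=> s0 st ts t1; have t0 : 0 < t by lra.
  rewrite /c s0 t0.
  have T0 : 0 < t^-1 by rewrite invr_gt0.
  have TS : t^-1 < s^-1 by rewrite ltf_pV2.
  have T1 : 1 <= t^-1 by rewrite invr_ge1 ?unitfE ?gt_eqF// t1.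
  apply: (speed_inversion lambda0 K0 (f0 (1 / 16)) (dist_ge0 _ _) s0 st ts KE).
  have T20 : 0 < t^-1 / 2 by rewrite divr_gt0.
  have T40 : 0 < t^-1 / 2 / 2 by rewrite divr_gt0.
  have T80 : 0 < t^-1 / 2 / 2 / 2 by rewrite divr_gt0.
  apply: (@le_trans _ _ (1024 * (s^-1 - t^-1) ^+ 2 * f (t^-1 / 2 / 2 / 2 / 2))).
    rewrite distC; apply: (speed_at_infinity lambda0 T0).
    - have := @EVI_flow_speed (t^-1 / 2) t^-1 (s^-1 - t^-1) T20.
      rewrite subr_gt0 [t^-1 + _]addrC subrK; apply=> //; lra.
    - exact: EVI_flow_energy_dist_min.
    - exact: EVI_flow_dist_min_halve.
    - exact: EVI_flow_dist_min_halve.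
  apply: ler_wpM2l; first exact: mulr_ge0 (ler0n _ _) (sqr_ge0 _).
  by apply: fmono => //; lra.
have cc : dist (c s) (c 0) @[s --> 0^'+] --> 0.
  rewrite c0; apply/cvgr0Pnorm_lt => e e0.
  (* Halving at time [1 / s] gives [lambda * f (1 / s) <= 2 * f (1 / 2) * s], hence continuity at 0.
     The added 1 keeps the divisor positive when [f (1 / 2)] vanishes. *)
  have G0 : 0 < 2 * f (1 / 2) + 1 by have := f0 (1 / 2); lra.
  near=> s.
  have s0 : 0 < s by near: s; exact: nbhs_right_gt.
  have s1 : s < 1 by near: s; exact: nbhs_right_lt.
  have sG : s < lambda * e ^+ 2 / (2 * f (1 / 2) + 1).
    by near: s; apply: nbhs_right_lt; rewrite divr_gt0// mulr_gt0// exprn_gt0.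
  rewrite ltr_pdivlMr// in sG.
  rewrite /c s0 ger0_norm// -(ltr_pXn2r (n := 2))// ?nnegrE ?(ltW e0)//.
  have S1 : 1 < s^-1 by rewrite invf_gt1.
  have := EVI_flow_dist_min_halve (t := s^-1) ltac:(lra).
  rewrite -/(f _) -/(f _) => h1.
  have h2 := fmono (1 / 2) (s^-1 / 2) ltac:(lra) ltac:(lra).
  have : lambda * f s^-1 <= 2 * f (1 / 2) * s.
    have -> : lambda * f s^-1 = lambda * s^-1 * f s^-1 * s by field; rewrite gt_eqF.
    by apply: ler_wpM2r; lra.
  have : 2 * f (1 / 2) * s < lambda * e ^+ 2 by lra.
  move=> h3 h4; have := le_lt_trans h4 h3; by rewrite ltr_pM2l.
exists K, c; split=> //.
- move=> s t s0; rewrite le_eqVlt => /predU1P[<- _|st t1].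
    by rewrite distxx subrr mulr0.
  exact: (lipschitz_of_dyadic distC dist_triangle cK cc (distxx _)).
- move=> t; rewrite le_eqVlt => /predU1P[<- _|t0 _]; first by rewrite c0.
  by rewrite /c t0; apply: gY; rewrite invr_gt0.
- by rewrite /c ltr01 invr1.
Unshelve. all: end_near.
Qed.

(* The substitution [t = s ^+ 4] turns the bound [t ^- (3 / 4)] on the speed
   into a constant. *)
Lemma EVI_flow_connected_start Y y C : (forall t, 0 < t -> Y (g t)) -> Y y ->
  dist (g t) y @[t --> 0^'+] --> 0 ->
  (forall s, 0 < s -> s <= 1 -> s * (fine (E (g (s ^+ 4))) - m) <= C) ->
  lipschitz_connected dist Y y (g 1).
Proof.
move=> gY Yy gy gC.
have C0 : 0 <= C.
  apply: le_trans (gC 1 ltr01 (lexx _)); rewrite mul1r subr_ge0.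
  by apply: mE; rewrite expr1n.
pose c s := if 0 < s then g (s ^+ 4) else y.
have c0 : c 0 = y by rewrite /c ltxx.
pose K := 960 * C + 1.
have K0 : 0 <= K by rewrite /K; lra.
have CK : 960 * C <= K ^+ 2 by rewrite /K; nra.
have cK s t : 0 < s -> s < t -> t <= 2 * s -> t <= 1 -> dist (c s) (c t) <= K * (t - s).
  move=> s0 st ts t1; have t0 : 0 < t by lra.
  rewrite /c s0 t0.
  have s40 : 0 < s ^+ 4 by rewrite exprn_gt0.
  have s20 : 0 < (s / 2) ^+ 4 by rewrite exprn_gt0// divr_gt0.
  (* The speed at time [s ^+ 4] is controlled by the energy at the earlier time [(s / 2) ^+ 4]; the
     gap between the two is of order [s ^+ 4]. *)
  apply: (speed_at_zero C0 (dist_ge0 _ _) K0 CK s0 st ts t1 (gC (s / 2) _ _)).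
  - by rewrite divr_gt0.
  - by lra.
  - have := @EVI_flow_speed ((s / 2) ^+ 4) (s ^+ 4) (t ^+ 4 - s ^+ 4) s20.
    rewrite subr_gt0 [s ^+ 4 + _]addrC subrK; apply.
      by rewrite ltr_pXn2r ?nnegrE ?ltW//; lra.
    by rewrite ltr_pXn2r ?nnegrE ?ltW.
have cc : dist (c s) (c 0) @[s --> 0^'+] --> 0.
  rewrite c0; apply/cvgr0Pnorm_lt => e e0.
  move/cvgr0Pnorm_lt: gy => /(_ e e0) [r /= r0 rP].
  near=> s.
  have s0 : 0 < s by near: s; exact: nbhs_right_gt.
  have s1 : s < 1 by near: s; exact: nbhs_right_lt.
  have sr : s < r by near: s; exact: nbhs_right_lt.
  rewrite /c s0; apply: rP; rewrite /= ?exprn_gt0// sub0r normrN gtr0_norm ?exprn_gt0//.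
  by apply: le_lt_trans sr; rewrite -[leRHS]expr1; apply: ler_wiXn2l; rewrite ?ltW.
exists K, c; split=> //.
- move=> s t s0; rewrite le_eqVlt => /predU1P[<- _|st t1].
    by rewrite distxx subrr mulr0.
  exact: (lipschitz_of_dyadic distC dist_triangle cK cc (distxx _)).
- move=> t; rewrite le_eqVlt => /predU1P[<- _|t0 _]; first by rewrite c0.
  by rewrite /c t0; apply: gY; rewrite exprn_gt0.
- by rewrite /c ltr01 expr1n.
Unshelve. all: end_near.
Qed.

End evi.

(** * The Wasserstein distance *)

Section mixture.
Context (R : realType) d (T : measurableType d) (mu : {measure set T -> \bar R}).
Context (F : nat -> set T) (mF : forall k, measurable (F k)) (w : nat -> {nonneg R}).

Let block k : {measure set T -> \bar R} := mscale (w k) (mrestr mu (mF k)).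

Let mixture : {measure set T -> \bar R} := mseries block 0.

(** Used twice: with a product measure to build couplings block by block, and with Lebesgue measure
    to build piecewise constant densities. *)
Lemma exists_mixture : (\sum_(0 <= k <oo) (w k)%:num%:E * mu (F k) = 1)%E ->
  exists P : probability T R, forall A, measurable A ->
    P A = (\sum_(0 <= k <oo) (w k)%:num%:E * mu (A `&` F k))%E.
Proof.
move=> w1; have mT : mixture setT = 1%E.
  rewrite -w1; apply: eq_eseriesr => k _.
  by rewrite /block/= /mscale/= /mrestr setTI.
pose B := Measure_isProbability.Build _ _ _ mixture mT.
pose P : probability T R := HB.pack (Measure.sort mixture) B.
by exists P.
Qed.

End mixture.

Lemma sum_measure_fibers (R : realType) d (T : measurableType d) (m : {measure set T -> \bar R})
    (h : T -> nat) A : (forall k, measurable (h @^-1` [set k])) -> measurable A ->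
  (\sum_(0 <= k <oo) m (A `&` h @^-1` [set k]))%E = m A.
Proof.
move=> mh mA; rewrite -measure_semi_bigcup.
- by rewrite -setI_bigcupr -preimage_bigcup bigcup_imset1 image_id preimage_setT setIT.
- by move=> k; exact: measurableI.
- by move=> i j _ _ [x [[_ <-] [_ <-]]].
- by apply: bigcupT_measurable => k; exact: measurableI.
Qed.

Section block_coupling.
Context (R : realType) d1 d2 (T1 : measurableType d1) (T2 : measurableType d2).
Context (mu : probability T1 R) (nu : probability T2 R).
Context (f : T1 -> nat) (g : T2 -> nat).
Context (mf : forall k, measurable (f @^-1` [set k])).
Context (mg : forall k, measurable (g @^-1` [set k])).
Context (fg : forall k, mu (f @^-1` [set k]) = nu (g @^-1` [set k])).

Let mass k : R := fine (mu (f @^-1` [set k])).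

Let massE k : mu (f @^-1` [set k]) = (mass k)%:E.
Proof. by rewrite fineK// fin_num_measure. Qed.

Let mass_ge0 k : 0 <= (mass k)^-1.
Proof. by rewrite invr_ge0 fine_ge0. Qed.

Let mblock k : measurable ((f @^-1` [set k]) `*` (g @^-1` [set k])).
Proof. exact: measurableX. Qed.

Let block k (S : set (T1 * T2)) : \bar R := ((mass k)^-1%:E *
  (mu \x nu)%E (S `&` ((f @^-1` [set k]) `*` (g @^-1` [set k]))))%E.

Let blockE k A B : measurable A -> measurable B ->
  block k (A `*` B) = ((mass k)^-1%:E * (mu (A `&` f @^-1` [set k]) *
    nu (B `&` g @^-1` [set k])))%E.
Proof.
move=> mA mB; rewrite /block -setXI product_measure1E//.
- exact: measurableI.
- exact: measurableI.
Qed.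

Let blockl k A : measurable A -> block k (A `*` setT) = mu (A `&` f @^-1` [set k]).
Proof.
move=> mA; rewrite blockE// setTI -fg massE.
(* A null block gets the weight [0^-1 = 0], in agreement with its vanishing marginal. *)
have [m0|m0] := eqVneq (mass k) 0; last first.
  by rewrite muleCA -EFinM mulVf// mule1.
rewrite m0 invr0 mul0e; apply/esym; have m0' : mu (f @^-1` [set k]) = 0%E by rewrite massE m0.
by apply: subset_measure0 m0' => //; first [exact: measurableI|exact: subIsetr].
Qed.

Let blockr k B : measurable B -> block k (setT `*` B) = nu (B `&` g @^-1` [set k]).
Proof.
move=> mB; rewrite blockE// setTI massE.
have [m0|m0] := eqVneq (mass k) 0; last first.
  by rewrite muleA -EFinM mulVf// mul1e.
rewrite m0 invr0 mul0e; apply/esym; have m0' : nu (g @^-1` [set k]) = 0%E by rewrite -fg massE m0.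
by apply: subset_measure0 m0' => //; first [exact: measurableI|exact: subIsetr].
Qed.

Let sum_blockl A : measurable A ->
  (\sum_(0 <= k <oo) block k (A `*` setT) = mu A)%E.
Proof.
move=> mA; rewrite (eq_eseriesr (fun k _ => blockl k mA)).
exact: sum_measure_fibers.
Qed.

Let sum_blockr B : measurable B ->
  (\sum_(0 <= k <oo) block k (setT `*` B) = nu B)%E.
Proof.
move=> mB; rewrite (eq_eseriesr (fun k _ => blockr k mB)).
exact: sum_measure_fibers.
Qed.

Let measurable_agree : measurable [set p : T1 * T2 | f p.1 = g p.2].
Proof.
rewrite (_ : mkset _ = \bigcup_k ((f @^-1` [set k]) `*` (g @^-1` [set k]))).
  by apply: bigcupT_measurable => k; exact: measurableX.
by apply/seteqP; split=> [p/= pE|p [k _ [/= -> ->]]//]; exists (f p.1).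
Qed.

(** [G] is the sum over [k] of the products of [mu] and [nu] restricted to their [k]-th blocks, each
    divided by the common mass of the two blocks. *)
Lemma block_coupling : exists G : probability (T1 * T2)%type R,
  [/\ forall A, measurable A -> G (fst @^-1` A) = mu A,
      forall B, measurable B -> G (snd @^-1` B) = nu B,
      measurable [set p : T1 * T2 | f p.1 <> g p.2] &
      G [set p | f p.1 <> g p.2] = 0%E].
Proof.
have mN : measurable [set p : T1 * T2 | f p.1 <> g p.2].
  exact: measurableC measurable_agree.
have [|G GE] := @exists_mixture _ _ _ (mu \x nu)%E _ mblock
    (fun k => NngNum (mass_ge0 k)).
  rewrite -(@probability_setT _ _ _ mu) -(sum_blockl measurableT).
  by apply: eq_eseriesr => k _; rewrite /block setXTT setTI.
exists G; split=> // [A mA|B mB|].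
- rewrite -setXT GE; last exact: measurableX.
  exact: sum_blockl.
- rewrite -setTX GE; last exact: measurableX.
  exact: sum_blockr.
rewrite GE//; apply: eseries0 => k _ _.
rewrite (_ : _ `&` _ = set0) ?measure0 ?mule0//.
by apply/seteqP; split=> // p [/= fgp [/= fk gk]]; apply: fgp; rewrite fk gk.
Qed.

End block_coupling.

Lemma ge0_integral_image_measure d d' (T : measurableType d) (T' : measurableType d')
    (R : realType) (m : {measure set T -> \bar R}) (m' : {measure set T' -> \bar R})
    (h : T -> T') (f : T' -> \bar R) :
  measurable_fun setT h -> (forall A, measurable A -> m (h @^-1` A) = m' A) ->
  measurable_fun setT f -> (forall x, (0 <= f x)%E) ->
  (\int[m]_x f (h x) = \int[m']_x f x)%E.
Proof.
move=> mh mm' mf f0.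
rewrite -(ge0_integral_pushforward mh m measurableT mf)//.
by apply: eq_measure_integral => A mA _; exact: mm'.
Qed.

Lemma exists_pushforward_probability d d' (T : measurableType d)
    (T' : measurableType d') (R : realType) (P : probability T R) (h : T -> T') :
  measurable_fun setT h ->
  exists Q : probability T' R, forall A, measurable A -> P (h @^-1` A) = Q A.
Proof.
move=> mh; pose X : {mfun T >-> T'} := HB.pack h (isMeasurableFun.Build _ _ _ _ h mh).
by exists (distribution P X).
Qed.

(** * Squared Euclidean norm and grid cells *)

Section sqnorm2.
Context (R : realType) (d : nat).
Implicit Types (x y z : 'rV[R]_d) (r : R).

Lemma sqnorm2_ge0 x : 0 <= sqnorm2 x.
Proof. by apply: sumr_ge0 => i _; exact: sqr_ge0. Qed.

Lemma measurable_sqnorm2 d1 (T : measurableType d1) (f : T -> 'rV[R]_d) :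
  (forall i, measurable_fun setT (fun t => f t ord0 i)) ->
  measurable_fun setT (fun t => (sqnorm2 (f t))%:E).
Proof.
move=> mf; apply/measurable_EFinP; apply: measurable_sum => i.
exact: measurable_funX.
Qed.

Lemma measurable_sqnorm2B d1 (T : measurableType d1) (f g : T -> 'rV[R]_d) :
  measurable_fun setT f -> measurable_fun setT g ->
  measurable_fun setT (fun t => (sqnorm2 (f t - g t))%:E).
Proof.
move=> mf mg; apply: measurable_sqnorm2 => i.
under eq_fun do rewrite !mxE.
apply: measurable_funB.
- exact: (measurableT_comp (measurable_rV_coor (i : 'I_d)) mf).
- exact: (measurableT_comp (measurable_rV_coor (i : 'I_d)) mg).
Qed.

Lemma sqnorm2BC x y : sqnorm2 (x - y) = sqnorm2 (y - x).
Proof. by apply: eq_bigr => i _; rewrite !mxE -sqrrN opprB. Qed.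

Lemma sqnorm2D_le x y : sqnorm2 (x + y) <= 2 * sqnorm2 x + 2 * sqnorm2 y.
Proof.
rewrite /sqnorm2 !mulr_sumr -big_split/=; apply: ler_sum => i _; rewrite mxE.
by have := sqr_ge0 (x ord0 i - y ord0 i); lra.
Qed.

Lemma sqnorm2N x : sqnorm2 (- x) = sqnorm2 x.
Proof. by apply: eq_bigr => i _; rewrite !mxE sqrrN. Qed.

(** Weighted Cauchy-Schwarz inequality. With weights equal to the three transport lengths it
    integrates to the square of their sum, and so replaces Minkowski's inequality in the triangle
    inequality. *)
Lemma sqnorm2D3_le (a b c : R) x y z : 0 < a -> 0 < b -> 0 < c ->
  sqnorm2 (x + y + z) <=
  (a + b + c) * (a^-1 * sqnorm2 x + b^-1 * sqnorm2 y + c^-1 * sqnorm2 z).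
Proof.
move=> a0 b0 c0; rewrite /sqnorm2 !mulr_sumr -!big_split/= mulr_sumr.
apply: ler_sum => i _; rewrite !mxE.
move: (x ord0 i) (y ord0 i) (z ord0 i) => u v w; rewrite -subr_ge0.
have -> : (a + b + c) * (a^-1 * u ^+ 2 + b^-1 * v ^+ 2 + c^-1 * w ^+ 2) -
    (u + v + w) ^+ 2 = (u * b - v * a) ^+ 2 / (a * b) +
    (u * c - w * a) ^+ 2 / (a * c) + (v * c - w * b) ^+ 2 / (b * c).
  by field; rewrite !gt_eqF.
by rewrite !addr_ge0// divr_ge0 ?sqr_ge0// mulr_ge0// ltW.
Qed.

(** Block couplings index their partitions by [nat], so [pickle] encodes the integer coordinates of
    the cube. Naturals that encode no cube have an empty cell. *)
Definition cell_index r x : nat := pickle (\row_i Num.floor (x ord0 i / r)).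

Lemma cell_index_eq r x y : cell_index r x = cell_index r y <->
  forall i, Num.floor (x ord0 i / r) = Num.floor (y ord0 i / r).
Proof.
split=> [/(pcan_inj pickleK)/rowP xy i|xy]; first by have := xy i; rewrite !mxE.
by congr pickle; apply/rowP => i; rewrite !mxE.
Qed.

Lemma cell_box r x : 0 < r -> cell_index r @^-1` [set cell_index r x] =
  [set y | forall i, [set` `[(Num.floor (x ord0 i / r))%:~R * r,
                            (Num.floor (x ord0 i / r) + 1)%:~R * r[] (y ord0 i)].
Proof.
move=> r0; apply/seteqP; split=> y /=.
  move/cell_index_eq => yx i; rewrite in_itv/= -yx -ler_pdivlMr// -ltr_pdivrMr//.
  exact: floor_itv.
move=> yx; apply/cell_index_eq => i; apply: floor_def.
by have := yx i; rewrite in_itv/= -ler_pdivlMr// -ltr_pdivrMr.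
Qed.

Lemma measurable_cell r k : 0 < r -> measurable (cell_index r @^-1` [set k]).
Proof.
move=> r0; have [[x <-]|nx] := pselect (exists x, cell_index r x = k); last first.
  by rewrite (_ : _ @^-1` _ = set0)//; apply/seteqP; split=> // x xk; apply: nx; exists x.
have -> : cell_index r @^-1` [set cell_index r x] =
    \bigcap_(i in [set: 'I_d]) (rV_coor i @^-1`
      `[(Num.floor (x ord0 i / r))%:~R * r, (Num.floor (x ord0 i / r) + 1)%:~R * r[).
  rewrite cell_box//.
  by apply/seteqP; split=> y /= yx i; [move=> _; exact: yx|exact: yx].
apply: fin_bigcap_measurable => // i _; rewrite -[X in measurable X]setTI.
exact: measurable_rV_coor.
Qed.

Lemma lebesgue_cell r x : 0 < r ->
  lebesgue_rV R d (cell_index r @^-1` [set cell_index r x]) = (r ^+ d)%:E.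
Proof.
move=> r0; rewrite cell_box// (@lebesgue_rV_box _ _ (fun i =>
  [set` `[(Num.floor (x ord0 i / r))%:~R * r, (Num.floor (x ord0 i / r) + 1)%:~R * r[]))//.
rewrite (eq_bigr (fun=> r%:E)) => [|i _].
  by rewrite prodEFin prodr_const card_ord.
rewrite lebesgue_measure_itv/= lte_fin ltr_pM2r// ltr_int ltzD1 lexx -EFinB.
by rewrite -mulrBl intrD addrC addKr mul1r.
Qed.

Lemma cell_index_dist r x y : 0 < r -> cell_index r x = cell_index r y ->
  sqnorm2 (x - y) <= d%:R * r ^+ 2.
Proof.
move=> r0 /cell_index_eq xy.
rewrite -[d in d%:R]card_ord -sum1_card natr_sum mulr_suml.
apply: ler_sum => i _; rewrite mul1r !mxE -[leLHS]real_normK ?num_real//.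
rewrite ler_pXn2r ?nnegrE ?(ltW r0)//.
have /andP[x1 x2] := floor_itv (x ord0 i / r).
have /andP[] := floor_itv (y ord0 i / r); rewrite -xy => y1 y2.
rewrite intrD in x2 y2.
have xy1 : x ord0 i / r - y ord0 i / r < 1 by lra.
have xy2 : - 1 < x ord0 i / r - y ord0 i / r by lra.
rewrite -mulrBl in xy1 xy2; rewrite ltr_pdivrMr// in xy1; rewrite ltr_pdivlMr// in xy2.
by rewrite ler_norml; apply/andP; split; lra.
Qed.

End sqnorm2.

(** * Pseudometric properties of [W2] *)

Section W2_pseudometric.
Context (R : realType) (d : nat).
Implicit Types (mu nu : P2 R d) (pi : probability ('rV[R]_d * 'rV[R]_d)%type R).
Implicit Types (e r c : R).

Definition transport_cost pi : \bar R :=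
  (\int[pi]_p (sqnorm2 (p.1 - p.2))%:E)%E.

Let measurable_cost :
  measurable_fun setT (fun p : 'rV[R]_d * 'rV[R]_d => (sqnorm2 (p.1 - p.2))%:E).
Proof. exact: measurable_sqnorm2B measurable_fst measurable_snd. Qed.

Lemma measurable_sqnorm2_id : measurable_fun setT (fun x : 'rV[R]_d => (sqnorm2 x)%:E).
Proof. by apply: measurable_sqnorm2 => i; exact: (measurable_rV_coor i). Qed.

Lemma transport_cost_ge0 pi : (0 <= transport_cost pi)%E.
Proof. by apply: integral_ge0 => p _; rewrite lee_fin sqnorm2_ge0. Qed.

Lemma integral_coupling_fst mu nu pi (f : 'rV[R]_d -> \bar R) : coupling mu nu pi ->
  measurable_fun setT f -> (forall x, (0 <= f x)%E) ->
  (\int[pi]_p f p.1 = \int[mu]_x f x)%E.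
Proof.
move=> munu mf f0; apply: ge0_integral_image_measure => // A mA.
by have [] := munu A mA.
Qed.

Lemma integral_coupling_snd mu nu pi (f : 'rV[R]_d -> \bar R) : coupling mu nu pi ->
  measurable_fun setT f -> (forall x, (0 <= f x)%E) ->
  (\int[pi]_p f p.2 = \int[nu]_x f x)%E.
Proof.
move=> munu mf f0; apply: ge0_integral_image_measure => // A mA.
by have [] := munu A mA.
Qed.

Lemma transport_cost_lty mu nu pi : coupling mu nu pi -> (transport_cost pi < +oo)%E.
Proof.
move=> munu.
apply: (@le_lt_trans _ _ (\int[pi]_p (2%:E * (sqnorm2 p.1)%:E + 2%:E * (sqnorm2 p.2)%:E))%E).
  apply: le_integral_nonmeasurable => p _.
    by rewrite -!EFinM -EFinD lee_fin addr_ge0// mulr_ge0// sqnorm2_ge0.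
  by rewrite -!EFinM -EFinD lee_fin (le_trans (sqnorm2D_le _ _))// sqnorm2N.
have m1 : measurable_fun setT (fun p : 'rV[R]_d * 'rV[R]_d => (sqnorm2 p.1)%:E).
  exact: measurableT_comp measurable_sqnorm2_id measurable_fst.
have m2 : measurable_fun setT (fun p : 'rV[R]_d * 'rV[R]_d => (sqnorm2 p.2)%:E).
  exact: measurableT_comp measurable_sqnorm2_id measurable_snd.
have s0 (x : 'rV[R]_d) : (0 <= (sqnorm2 x)%:E)%E by rewrite lee_fin sqnorm2_ge0.
rewrite ge0_integralD//; last 4 first.
- by move=> p _; rewrite mule_ge0// s0.
- exact: measurable_funeM.
- by move=> p _; rewrite mule_ge0// s0.
- exact: measurable_funeM.
rewrite !ge0_integralZl//.
rewrite (integral_coupling_fst munu measurable_sqnorm2_id s0).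
rewrite (integral_coupling_snd munu measurable_sqnorm2_id s0).
by rewrite lte_add_pinfty// lte_mul_pinfty// ?P2_moment.
Qed.

(** The block coupling with a single block is the product coupling. *)
Lemma exists_coupling mu nu : exists pi, coupling mu nu pi.
Proof.
have [||| G [G1 G2 _ _]] := @block_coupling R _ _ _ _ mu nu (fun=> 0%N) (fun=> 0%N).
- by move=> k; rewrite preimage_cst; case: ifPn.
- by move=> k; rewrite preimage_cst; case: ifPn.
- by move=> k; rewrite !preimage_cst; case: ifPn; rewrite ?measure0 ?probability_setT.
by exists G => A mA; split; [exact: G1|exact: G2].
Qed.

Let W2_inf mu nu := ereal_inf [set transport_cost pi | pi in coupling mu nu].

Let W2_inf_fin_num mu nu : W2_inf mu nu \is a fin_num.
Proof.
have [pi munu] := exists_coupling mu nu.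
rewrite ge0_fin_numE; last first.
  by apply: le_ereal_inf_tmp => _ [p _ <-]; exact: transport_cost_ge0.
apply: le_lt_trans (transport_cost_lty munu).
by apply: ereal_inf_lbound; exists pi.
Qed.

Let W2_infE mu nu : W2_inf mu nu = (W2 mu nu ^+ 2)%:E.
Proof.
rewrite /W2 sqr_sqrtr; first by rewrite fineK//; exact: W2_inf_fin_num.
apply: fine_ge0; apply: le_ereal_inf_tmp => _ [p _ <-].
exact: transport_cost_ge0.
Qed.

Lemma W2_ge0 mu nu : 0 <= W2 mu nu.
Proof. exact: sqrtr_ge0. Qed.

Lemma W2_le mu nu pi c : 0 <= c -> coupling mu nu pi ->
  (transport_cost pi <= (c ^+ 2)%:E)%E -> W2 mu nu <= c.
Proof.
move=> c0 munu pic; rewrite -(ler_pXn2r (n := 2))// ?nnegrE ?W2_ge0// -lee_fin.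
rewrite -W2_infE; apply: le_trans pic.
by apply: ereal_inf_lbound; exists pi.
Qed.

Lemma W2_almost_optimal mu nu e : 0 < e -> exists2 pi, coupling mu nu pi &
  (transport_cost pi <= ((W2 mu nu + e) ^+ 2)%:E)%E.
Proof.
move=> e0.
have : (W2_inf mu nu < ((W2 mu nu + e) ^+ 2)%:E)%E.
  rewrite W2_infE lte_fin ltr_pXn2r ?nnegrE ?addr_ge0 ?W2_ge0 ?(ltW e0)//.
  by rewrite ltrDl.
by move=> /ereal_inf_lt[_ [pi munu <-]] /ltW; exists pi.
Qed.

Lemma W2_sym mu nu : W2 mu nu = W2 nu mu.
Proof.
suff H (m n : P2 R d) : W2 m n <= W2 n m by apply/eqP; rewrite eq_le !H.
apply/ler_addgt0Pr => e e0.
have [pi nm pie] := @W2_almost_optimal n m _ e0.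
have msw : measurable_fun setT (fun p : 'rV[R]_d * 'rV[R]_d => (p.2, p.1)).
  exact: measurable_fun_pair measurable_snd measurable_fst.
have [Q QE] := exists_pushforward_probability pi msw.
apply: (@W2_le m n Q); first by rewrite addr_ge0 ?W2_ge0 ?ltW.
  move=> A mA; have [h1 h2] := nm A mA; split; rewrite -QE ?h1 ?h2//.
    by rewrite -[X in measurable X]setTI; exact: measurable_fst.
  by rewrite -[X in measurable X]setTI; exact: measurable_snd.
apply: le_trans pie; rewrite /transport_cost.
rewrite -(ge0_integral_image_measure msw QE)//=; last first.
  by move=> p; rewrite lee_fin sqnorm2_ge0.
by under eq_integral do rewrite sqnorm2BC.
Qed.

(** Coupling cell by cell moves mass only inside cells, whose squared diameter is at most
    [d * r ^+ 2]; [d + 1] bounds the square root of [d]. *)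
Lemma W2_cell_le mu nu r : 0 < r ->
  (forall k, mu (cell_index r @^-1` [set k]) = nu (cell_index r @^-1` [set k])) ->
  W2 mu nu <= (d%:R + 1) * r.
Proof.
move=> r0 munu.
have [G [G1 G2 mN GN]] := block_coupling (fun k => measurable_cell k r0)
  (fun k => measurable_cell k r0) munu.
apply: (@W2_le mu nu G); first by rewrite mulr_ge0 ?addr_ge0// ltW.
  by move=> A mA; split; [exact: G1|exact: G2].
apply: (@le_trans _ _ (\int[G]_p ((d%:R * r ^+ 2)%:E))%E).
  apply: ae_ge0_le_integral => //.
  - by move=> p _; rewrite lee_fin sqnorm2_ge0.
  - by move=> p _; rewrite lee_fin mulr_ge0// sqr_ge0.
  exists [set p | cell_index r p.1 <> cell_index r p.2]; split=> // p/= np pp.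
  by apply: np => _; rewrite lee_fin; exact: cell_index_dist.
rewrite integral_cst// [X in (_ * X)%E]probability_setT mule1 lee_fin exprMn.
apply: ler_wpM2r; first exact: sqr_ge0.
by have := ler0n R d; nra.
Qed.

(** The cell bound on arbitrarily fine grids replaces the diagonal coupling. *)
Lemma W2_refl mu : W2 mu mu = 0.
Proof.
suff : W2 mu mu <= 0 by have := W2_ge0 mu mu; lra.
apply/ler_addgt0Pr => e e0.
have d0 : 0 < d%:R + 1 :> R by rewrite ltr_wpDl.
rewrite add0r; apply: le_trans (@W2_cell_le mu mu (e / (d%:R + 1)) _ _) _ => //.
  by rewrite divr_gt0.
by rewrite mulrC divfK// gt_eqF.
Qed.

(* Optimal plans are glued along the cells of a fine grid, which avoids
   disintegrating them with respect to the common marginal. *)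
Lemma W2_triangle mu1 mu2 mu3 : W2 mu1 mu3 <= W2 mu1 mu2 + W2 mu2 mu3.
Proof.
apply/ler_addgt0Pr => e' e'0.
have e0 : 0 < e' / 3 by rewrite divr_gt0.
set e := e' / 3 in e0.
have [p12 c12 e12] := @W2_almost_optimal mu1 mu2 _ e0.
have [p23 c23 e23] := @W2_almost_optimal mu2 mu3 _ e0.
set a := W2 mu1 mu2 + e in e12; set b := W2 mu2 mu3 + e in e23.
have a0 : 0 < a by rewrite ltr_wpDl ?W2_ge0.
have b0 : 0 < b by rewrite ltr_wpDl ?W2_ge0.
have -> : W2 mu1 mu2 + W2 mu2 mu3 + e' = a + b + e.
  by rewrite /a /b /e; field.
have d0 : 0 < d%:R + 1 :> R by rewrite ltr_wpDl.
pose r := e / (d%:R + 1).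
have r0 : 0 < r by rewrite divr_gt0.
have re : d%:R * r ^+ 2 <= e ^+ 2.
  have -> : e = (d%:R + 1) * r by rewrite mulrC divfK// gt_eqF.
  rewrite [leRHS]exprMn; apply: ler_wpM2r; first exact: sqr_ge0.
  by have := ler0n R d; nra.
have m12 k : measurable ((cell_index r \o snd) @^-1` [set k] : set ('rV[R]_d * 'rV[R]_d)).
  rewrite comp_preimage -[X in measurable X]setTI.
  by apply: measurable_snd => //; exact: measurable_cell.
have m23 k : measurable ((cell_index r \o fst) @^-1` [set k] : set ('rV[R]_d * 'rV[R]_d)).
  rewrite comp_preimage -[X in measurable X]setTI.
  by apply: measurable_fst => //; exact: measurable_cell.
(* The second marginal of [p12] and the first of [p23] are both [mu2], so both plans give each cell
   the same mass. [G] then couples the two plans with their middle points almost surely in a common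
   cell. *)
have m123 k : p12 ((cell_index r \o snd) @^-1` [set k]) =
    p23 ((cell_index r \o fst) @^-1` [set k]).
  transitivity (mu2 (cell_index r @^-1` [set k])).
    exact: (c12 _ (measurable_cell k r0)).2.
  by apply/esym; exact: (c23 _ (measurable_cell k r0)).1.
have [G [G1 G2 mN GN]] := block_coupling m12 m23 m123.
have mh : measurable_fun setT (fun q : ('rV[R]_d * 'rV[R]_d) * ('rV[R]_d * 'rV[R]_d) =>
    (q.1.1, q.2.2)).
  apply: measurable_fun_pair; first exact: measurableT_comp measurable_fst measurable_fst.
  exact: measurableT_comp measurable_snd measurable_snd.
have [Q QE] := exists_pushforward_probability G mh.
apply: (@W2_le _ _ Q); first exact: addr_ge0 (addr_ge0 (ltW a0) (ltW b0)) (ltW e0).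
  move=> A mA; split.
  - rewrite -QE; last by rewrite -[X in measurable X]setTI; exact: measurable_fst.
    rewrite -(c12 A mA).1 -G1//.
    by rewrite -[X in measurable X]setTI; exact: measurable_fst.
  - rewrite -QE; last by rewrite -[X in measurable X]setTI; exact: measurable_snd.
    rewrite -(c23 A mA).2 -G2//.
    by rewrite -[X in measurable X]setTI; exact: measurable_snd.
have s0 (x : 'rV[R]_d) : (0 <= (sqnorm2 x)%:E)%E by rewrite lee_fin sqnorm2_ge0.
rewrite /transport_cost -(ge0_integral_image_measure mh QE)//=.
pose s := a + b + e.
have s_ge0 : 0 <= s by exact: addr_ge0 (addr_ge0 (ltW a0) (ltW b0)) (ltW e0).
have mc1 : measurable_fun setT
    (fun q : ('rV[R]_d * 'rV[R]_d) * ('rV[R]_d * 'rV[R]_d) => (sqnorm2 (q.1.1 - q.1.2))%:E).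
  exact: measurableT_comp measurable_cost measurable_fst.
have mc2 : measurable_fun setT
    (fun q : ('rV[R]_d * 'rV[R]_d) * ('rV[R]_d * 'rV[R]_d) => (sqnorm2 (q.2.1 - q.2.2))%:E).
  exact: measurableT_comp measurable_cost measurable_snd.
have ai : (0 <= (a^-1)%:E)%E by rewrite lee_fin invr_ge0 ltW.
have bi : (0 <= (b^-1)%:E)%E by rewrite lee_fin invr_ge0 ltW.
have F0 (q : ('rV[R]_d * 'rV[R]_d) * ('rV[R]_d * 'rV[R]_d)) :
    (0 <= (a^-1)%:E * (sqnorm2 (q.1.1 - q.1.2))%:E +
          (b^-1)%:E * (sqnorm2 (q.2.1 - q.2.2))%:E + e%:E)%E.
  apply: adde_ge0; last by rewrite lee_fin ltW.
  by apply: adde_ge0; apply: mule_ge0.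
(* The weights [a], [b], [e] make the integral of the bracket at most [a + b + e = s], so that of
   [F] is at most [s ^+ 2]. *)
pose F (q : ('rV[R]_d * 'rV[R]_d) * ('rV[R]_d * 'rV[R]_d)) : \bar R :=
  (s%:E * ((a^-1)%:E * (sqnorm2 (q.1.1 - q.1.2))%:E +
           (b^-1)%:E * (sqnorm2 (q.2.1 - q.2.2))%:E + e%:E))%E.
apply: (@le_trans _ _ (\int[G]_q F q)%E).
  apply: ae_ge0_le_integral => //.
  - exact: measurableT_comp measurable_cost mh.
  - by move=> q _; apply: mule_ge0 (F0 q); rewrite lee_fin.
  - apply: measurable_funeM; apply: emeasurable_funD => //.
    by apply: emeasurable_funD; exact: measurable_funeM.
  exists [set q | (cell_index r \o snd) q.1 <> (cell_index r \o fst) q.2].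
  split=> // q/= np pp; apply: np => _.
  rewrite -[F q]/((s * (a^-1 * sqnorm2 (q.1.1 - q.1.2) +
    b^-1 * sqnorm2 (q.2.1 - q.2.2) + e))%:E) lee_fin.
  have -> : q.1.1 - q.2.2 = (q.1.1 - q.1.2) + (q.2.1 - q.2.2) + (q.1.2 - q.2.1).
    by apply/rowP => i; rewrite !mxE; ring.
  apply: le_trans (sqnorm2D3_le _ _ _ a0 b0 e0) _.
  apply: ler_wpM2l => //; rewrite lerD2l.
  rewrite mulrC ler_pdivrMr// -expr2.
  exact: le_trans (cell_index_dist r0 pp) re.
rewrite ge0_integralZl//; last first.
  apply: emeasurable_funD => //.
  by apply: emeasurable_funD; exact: measurable_funeM.
rewrite -/s (_ : (s ^+ 2)%:E = s%:E * s%:E)%E; last by rewrite expr2 EFinM.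
apply: (@lee_wpmul2l _ s%:E); first by rewrite lee_fin.
rewrite ge0_integralD//; last 3 first.
- by move=> q _; rewrite adde_ge0 ?mule_ge0.
- by apply: emeasurable_funD; exact: measurable_funeM.
- by move=> q _; rewrite lee_fin ltW.
rewrite ge0_integralD//; last 4 first.
- by move=> q _; rewrite mule_ge0.
- exact: measurable_funeM.
- by move=> q _; rewrite mule_ge0.
- exact: measurable_funeM.
rewrite !ge0_integralZl//.
have -> : (\int[G]_q e%:E = e%:E)%E.
  by rewrite integral_cst// [X in (_ * X)%E]probability_setT mule1.
rewrite (ge0_integral_image_measure measurable_fst G1 measurable_cost)//.
rewrite (ge0_integral_image_measure measurable_snd G2 measurable_cost)//.
rewrite -[s%:E]/(a%:E + b%:E + e%:E)%E; apply: leeD => //; apply: leeD.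
  apply: le_trans (lee_wpmul2l ai e12) _.
  by rewrite -EFinM lee_fin expr2 mulrA mulVf ?mul1r// gt_eqF.
apply: le_trans (lee_wpmul2l bi e23) _.
by rewrite -EFinM lee_fin expr2 mulrA mulVf ?mul1r// gt_eqF.
Qed.

End W2_pseudometric.

(** * Energy of discretized measures *)

Section discretization.
Context (R : realType) (d : nat) (rho : P2 R d) (r : R) (r0 : 0 < r).

Let cell k : set 'rV[R]_d := cell_index r @^-1` [set k].

Let mcell k : measurable (cell k). Proof. exact: measurable_cell. Qed.

Let weight k : R := fine (rho (cell k)) / r ^+ d.

Let weight_ge0 k : 0 <= weight k.
Proof. by rewrite divr_ge0 ?fine_ge0// exprn_ge0// ltW. Qed.

Let weight_le k : weight k <= (r ^+ d)^-1.
Proof.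
rewrite ler_piMl ?invr_ge0 ?exprn_ge0 ?(ltW r0)// -lee_fin fineK ?fin_num_measure//.
exact: probability_le1.
Qed.

Let weight_cell k : ((weight k)%:E * lebesgue_rV R d (cell k) = rho (cell k))%E.
Proof.
have [[x <-]|nx] := pselect (exists x : 'rV[R]_d, cell_index r x = k).
  rewrite /cell lebesgue_cell// -EFinM /weight divfK ?fineK ?fin_num_measure//.
  by rewrite gt_eqF// exprn_gt0.
suff -> : cell k = set0 by rewrite !measure0 mule0.
by apply/seteqP; split=> // x xk; apply: nx; exists x.
Qed.

Let density (x : 'rV[R]_d) : R := weight (cell_index r x).

Let measurable_density : measurable_fun setT density.
Proof.
move=> _ B mB; rewrite setTI.
have -> : density @^-1` B = \bigcup_(k in weight @^-1` B) cell k.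
  by apply/seteqP; split=> [x Bx|x [k Bk xk]]; [exists (cell_index r x)|rewrite /density/= xk].
exact: bigcup_measurable.
Qed.

Let density_integral A : measurable A ->
  (\int[lebesgue_rV R d]_(x in A) (density x)%:E =
   \sum_(0 <= k <oo) (weight k)%:E * lebesgue_rV R d (A `&` cell k))%E.
Proof.
move=> mA.
have AE : A = \bigcup_k (A `&` cell k).
  by rewrite -setI_bigcupr -preimage_bigcup bigcup_imset1 image_id preimage_setT setIT.
rewrite [in LHS]AE ge0_integral_bigcup//; last 4 first.
- by move=> k; exact: measurableI.
- apply/measurable_EFinP; exact: measurable_funS measurable_density.
- by move=> x _; rewrite lee_fin weight_ge0.
- by move=> i j _ _ [x [[_ <-] [_ <-]]].
apply: eq_eseriesr => k _.
rewrite (eq_integral (cst (weight k)%:E)); last by move=> x /[!inE] -[_ <-].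
by rewrite integral_cst//; exact: measurableI.
Qed.

Let exists_smear : exists smear : probability 'rV[R]_d R, forall A, measurable A ->
  smear A = (\int[lebesgue_rV R d]_(x in A) (density x)%:E)%E.
Proof.
have [|P PE] := @exists_mixture _ _ _ (lebesgue_rV R d) _ mcell
    (fun k => NngNum (weight_ge0 k)).
  rewrite -(@probability_setT _ _ _ rho) -(sum_measure_fibers rho mcell measurableT).
  by apply: eq_eseriesr => k _; rewrite setTI; exact: weight_cell.
by exists P => A mA; rewrite PE// density_integral.
Qed.

Section smear.
Context (smear : probability 'rV[R]_d R).
Context (smearE : forall A, measurable A ->
  smear A = (\int[lebesgue_rV R d]_(x in A) (density x)%:E)%E).

Let smear_cell k : smear (cell k) = rho (cell k).
Proof.
rewrite smearE// (eq_integral (cst (weight k)%:E)); last by move=> x /[!inE] <-.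
by rewrite integral_cst.
Qed.

(** Under the cellwise coupling with [rho], a point is at squared distance at most [d * r ^+ 2] from
    its partner, whose squared norm is integrable. *)
Let smear_moment : (\int[smear]_x (sqnorm2 x)%:E <=
  2%:E * \int[rho]_x (sqnorm2 x)%:E + (2 * d%:R * r ^+ 2)%:E)%E.
Proof.
have [G [G1 G2 mN GN]] := @block_coupling _ _ _ _ _ rho smear _ _ mcell mcell
  (fun k => esym (smear_cell k)).
have ms := @measurable_sqnorm2_id R d.
have s0 (x : 'rV[R]_d) : (0 <= (sqnorm2 x)%:E)%E by rewrite lee_fin sqnorm2_ge0.
have ms1 : measurable_fun setT (fun p : 'rV[R]_d * 'rV[R]_d => (sqnorm2 p.1)%:E).
  exact: measurableT_comp ms measurable_fst.
rewrite -(ge0_integral_image_measure measurable_snd G2 ms)//.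
have r20 : (0 <= (2 * d%:R * r ^+ 2)%:E)%E by rewrite lee_fin mulr_ge0 ?sqr_ge0// mulr_ge0.
apply: (@le_trans _ _ (\int[G]_p (2%:E * (sqnorm2 p.1)%:E + (2 * d%:R * r ^+ 2)%:E))%E).
  apply: ae_ge0_le_integral => //.
  - exact: measurableT_comp ms measurable_snd.
  - by move=> p _; apply: adde_ge0 => //; exact: mule_ge0.
  - by apply: emeasurable_funD => //; exact: measurable_funeM.
  exists [set p | cell_index r p.1 <> cell_index r p.2]; split=> // p/= np pp.
  apply: np => _; rewrite -EFinM -EFinD lee_fin.
  have := sqnorm2D_le (p.2 - p.1) p.1; rewrite subrK.
  have := cell_index_dist r0 (esym pp); lra.
rewrite ge0_integralD//; last 2 first.
- by move=> p _; exact: mule_ge0.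
- exact: measurable_funeM.
rewrite ge0_integralZl//.
rewrite (ge0_integral_image_measure measurable_fst G1 ms)//.
by rewrite integral_cst// [X in (_ + _ * X)%E]probability_setT mule1.
Qed.

Let smear_moment_lty : (\int[smear]_x (sqnorm2 x)%:E < +oo)%E.
Proof.
apply: le_lt_trans smear_moment _; rewrite lte_add_pinfty ?ltry//.
by rewrite lte_mul_pinfty// ?P2_moment.
Qed.

Lemma smear_discretization : exists z : P2 R d,
  [/\ W2 rho z <= (d%:R + 1) * r,
      (\int[z]_x (sqnorm2 x)%:E <=
        2%:E * \int[rho]_x (sqnorm2 x)%:E + (2 * d%:R * r ^+ 2)%:E)%E,
      exists f, is_density z f &
      forall A, measurable A -> (z A <= ((r ^+ d)^-1)%:E * lebesgue_rV R d A)%E].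
Proof.
exists (MkP2 smear_moment_lty); split.
- by apply: W2_cell_le => // k /=; rewrite smear_cell.
- exact: smear_moment.
- by exists density; split=> // x; exact: weight_ge0.
move=> A mA /=; rewrite smearE// -integral_cst//.
apply: le_integral_nonmeasurable => x _; rewrite lee_fin; last exact: weight_le.
by rewrite invr_ge0 exprn_ge0// ltW.
Qed.

End smear.

(** [rho] is made uniform on each cell, with the same mass. The density bound appears as domination
    by Lebesgue measure because [entropy] selects a density of its own. *)
Lemma exists_discretization : exists z : P2 R d,
  [/\ W2 rho z <= (d%:R + 1) * r,
      (\int[z]_x (sqnorm2 x)%:E <=
        2%:E * \int[rho]_x (sqnorm2 x)%:E + (2 * d%:R * r ^+ 2)%:E)%E,
      exists f, is_density z f &
      forall A, measurable A -> (z A <= ((r ^+ d)^-1)%:E * lebesgue_rV R d A)%E].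
Proof. by have [z zE] := exists_smear; exact: smear_discretization zE. Qed.

End discretization.

(** * Entropy under a density bound *)

Section entropy_bound.
Context (R : realType) (d : nat) (rho : P2 R d) (M : R) (M1 : 1 <= M).
Context (rhoM : forall A, measurable A -> (rho A <= M%:E * lebesgue_rV R d A)%E).

(** On [N], where [f] exceeds [M], the mass of [rho] is the integral of [f - M] plus [M] times the
    volume. Domination leaves no room for the first term. *)
Lemma density_le_ae (f : 'rV[R]_d -> R) : is_density rho f ->
  {ae lebesgue_rV R d, forall x, f x <= M}.
Proof.
move=> [mf f0 rhof].
pose N := [set x | M < f x].
have mN : measurable N.
  have -> : N = f @^-1` `]M, +oo[.
    by apply/seteqP; split=> x; rewrite /N/= in_itv/= andbT.
  by rewrite -[X in measurable X]setTI; exact: mf.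
have mfM : measurable_fun N (fun x => (f x - M)%:E).
  apply/measurable_EFinP; apply: measurable_funB => //; exact: measurable_funS mf.
have fM0 x : N x -> (0 <= (f x - M)%:E)%E by move=> /ltW Nx; rewrite lee_fin subr_ge0.
have M0 : 0 <= M by exact: le_trans M1.
have rN : rho N = (\int[lebesgue_rV R d]_(x in N) (f x - M)%:E +
    M%:E * lebesgue_rV R d N)%E.
  rewrite rhof// -integral_cst// -ge0_integralD//.
  by apply: eq_integral => x _; rewrite -EFinD subrK.
have int0 : (\int[lebesgue_rV R d]_(x in N) (f x - M)%:E = 0)%E.
  apply/eqP; rewrite eq_le integral_ge0// andbT.
  (* Finiteness, inherited from [rho N], is what allows subtracting this term. *)
  have MN : (M%:E * lebesgue_rV R d N)%E \is a fin_num.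
    rewrite ge0_fin_numE ?mule_ge0//.
    apply: (@le_lt_trans _ _ (rho N)); last by rewrite -ge0_fin_numE// fin_num_measure.
    by rewrite rN leeDr// integral_ge0.
  by have := rhoM mN; rewrite rN -leeBrDr// subee.
have : ae_eq (lebesgue_rV R d) N (fun x => (f x - M)%:E) (cst 0%E).
  apply/ae_eq_integral_abs => //; rewrite -[RHS]int0.
  by apply: eq_integral => x /[!inE] Nx; rewrite gee0_abs// fM0.
apply: filterS => x/= Nx; rewrite leNgt; apply/negP => fxM.
by have /eqP := Nx fxM; rewrite eqe subr_eq0 gt_eqF.
Qed.

(** Almost everywhere [f * ln f <= ln M * f], and [f] has integral 1. As [ln M >= 0], the bound also
    holds for the positive part, which allows integration of nonnegative functions. *)
Lemma entropy_le : (exists f, is_density rho f) -> (entropy rho <= (ln M)%:E)%E.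
Proof.
rewrite /entropy; case: pselect => // h _.
move: (projT1 (cid h)) (projT2 (cid h)) => f fd.
have [mf f0 rhof] := fd.
have lnM : 0 <= ln M by exact: ln_ge0.
apply: (@le_trans _ _ (\int[lebesgue_rV R d]_x (Num.max (f x * ln (f x)) 0)%:E)%E).
  by apply: le_integral_nonmeasurable => x _; rewrite lee_fin le_max lexx ?orbT.
apply: (@le_trans _ _ (\int[lebesgue_rV R d]_x ((ln M)%:E * (f x)%:E))%E).
  apply: ae_ge0_le_integral => //.
  - by move=> x _; rewrite lee_fin le_max lexx orbT.
  - apply/measurable_EFinP; apply: measurable_maxr => //.
    by apply: measurable_funM => //; exact: measurableT_comp (@measurable_ln R) mf.
  - by move=> x _; rewrite mule_ge0// lee_fin.
  - by apply: measurable_funeM; exact/measurable_EFinP.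
  apply: filterS (density_le_ae fd) => x fxM _.
  rewrite lee_fin ge_max mulrC mulr_ge0// andbT.
  have [->|fx0] := eqVneq (f x) 0; first by rewrite !mulr0.
  apply: ler_wpM2r => //; rewrite ler_ln// posrE.
    by rewrite lt_neqAle eq_sym fx0 f0.
  exact: lt_le_trans ltr01 M1.
rewrite ge0_integralZl ?lee_fin//; last 2 first.
- exact/measurable_EFinP.
- by move=> x _; rewrite lee_fin.
by rewrite -rhof// probability_setT mule1.
Qed.

End entropy_bound.

(** * Quadratic growth of the potential *)

Section quadratic_growth.
Context (R : realType) (d : nat).
Implicit Types (f V : 'rV[R]_d -> R) (x y : 'rV[R]_d).

Lemma differentiable_derive_partial f x y : differentiable f y ->
  'D_x f y = \sum_(i < d) x ord0 i * partial i f y.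
Proof.
move=> fy; rewrite deriveE// {1}(row_sum_delta x) linear_sum/=.
apply: eq_bigr => i _; rewrite linearZ/= /partial deriveE//.
Qed.

Lemma is_derive_line f x (t : R) : differentiable f (t *: x) ->
  is_derive t 1 (fun s : R => f (s *: x)) ('D_x f (t *: x)).
Proof.
move=> dfx; have fx : derivable f (t *: x) x by exact: diff_derivable.
have E : (fun h : R => h^-1 *: (((fun s => f (s *: x)) \o shift t) (h *: 1) - f (t *: x))) =
         (fun h => h^-1 *: ((f \o shift (t *: x)) (h *: x) - f (t *: x))).
  by apply/funext => h /=; rewrite [h *: 1]mulr1 scalerDl.
by split; rewrite /derivable /derive E.
Qed.

Lemma differentiable_line_le f x (K s : R) : (forall y, differentiable f y) -> 0 <= s ->
  (forall t : R, 0 <= t -> t <= s -> `|\sum_(i < d) x ord0 i * partial i f (t *: x)| <= K) ->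
  `|f (s *: x) - f 0| <= K * s.
Proof.
move=> df s0 fK.
have der (t : R) : is_derive t 1 (fun s : R => f (s *: x)) ('D_x f (t *: x)).
  exact: is_derive_line.
have [|c] := @MVT_segment R (fun t : R => f (t *: x))
    (fun t : R => 'D_x f (t *: x)) 0 s s0 (fun t _ => der t).
  by apply: derivable_within_continuous => t _; have [] := der t.
rewrite in_itv/= scale0r subr0 => /andP[c0 cs] ->.
rewrite normrM (ger0_norm s0); apply: ler_wpM2r => //.
by rewrite differentiable_derive_partial//; exact: fK.
Qed.

(** The mean value theorem along rays from 0 is used twice: it bounds the partial derivatives
    linearly, then [V] quadratically, in the l1 norm [S]. *)
Lemma bounded_second_derivatives_quadratic V : bounded_second_derivatives V ->
  exists2 C : R, 0 <= C & forall x, V x <= C + C * sqnorm2 x.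
Proof.
move=> [dV dpV [C0 CP]]; pose C := `|C0|.
have CV i j x : `|partial j (partial i V) x| <= C.
  by apply: le_trans (CP i j x) _; exact: ler_norm.
have C_ge0 : 0 <= C by exact: normr_ge0.
pose B : R := \sum_(i < d) `|partial i V 0|.
have B0 : 0 <= B by exact: sumr_ge0.
pose S x : R := \sum_(i < d) `|x ord0 i|.
have S0 x : 0 <= S x by exact: sumr_ge0.
have S2 x : S x ^+ 2 <= d%:R * sqnorm2 x.
  (* Cauchy-Schwarz as the inequality of arithmetic and geometric means, summed over all pairs of
     coordinates. *)
  have E : d%:R * sqnorm2 x =
      \sum_(i < d) \sum_(j < d) (x ord0 i ^+ 2 + x ord0 j ^+ 2) / 2.
    have sumd (a : R) : \sum_(i < d) a = d%:R * a.
      by rewrite sumr_const card_ord mulr_natl.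
    under eq_bigr => i _ do rewrite -mulr_suml big_split/= sumd.
    rewrite -mulr_suml big_split/= sumd -mulr_sumr -/(sqnorm2 x).
    by field.
  rewrite E expr2 mulr_suml; apply: ler_sum => i _; rewrite mulr_sumr.
  apply: ler_sum => j _; have := sqr_ge0 (`|x ord0 i| - `|x ord0 j|).
  rewrite -[x ord0 i ^+ 2]real_normK ?num_real//.
  by rewrite -[x ord0 j ^+ 2]real_normK ?num_real//; lra.
have pV i x (t : R) : 0 <= t -> t <= 1 -> `|partial i V (t *: x)| <= `|partial i V 0| + C * S x.
  move=> t0 t1; rewrite -[partial i V _](subrK (partial i V 0)).
  apply: le_trans (ler_normD _ _) _; rewrite addrC lerD2l.
  apply: (@le_trans _ _ (C * S x * t)); last first.
    by apply: ler_piMr => //; rewrite mulr_ge0.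
  apply: differentiable_line_le => // u u0 ut.
  apply: le_trans (ler_norm_sum _ _ _) _; rewrite mulr_sumr.
  by apply: ler_sum => j _; rewrite normrM mulrC; apply: ler_wpM2r.
have VS x : V x <= `|V 0| + (B + C * S x) * S x.
  have : `|V (1 *: x) - V 0| <= (B + C * S x) * S x * 1.
    apply: differentiable_line_le => // t t0 t1.
    apply: le_trans (ler_norm_sum _ _ _) _; rewrite mulr_sumr.
    apply: ler_sum => i _; rewrite normrM mulrC; apply: ler_wpM2r => //.
    apply: le_trans (pV i x t t0 t1) _; rewrite lerD2r.
    by rewrite /B (bigD1 i)//= lerDl sumr_ge0.
  rewrite scale1r mulr1 ler_norml => /andP[_].
  by have := ler_norm (V 0); lra.
exists (`|V 0| + B + (B + C) * d%:R) => [|x].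
  by rewrite !addr_ge0// mulr_ge0// addr_ge0.
apply: (le_trans (VS x)).
have q0 := sqnorm2_ge0 x; have d0 := ler0n R d.
have h1 : B * S x <= B * (1 + d%:R * sqnorm2 x).
  by apply: ler_wpM2l => //; have := S2 x; have := sqr_ge0 (S x - 1); have := sqr_ge0 (S x); lra.
have h2 : C * S x ^+ 2 <= C * (d%:R * sqnorm2 x) by exact: ler_wpM2l.
have h3 : 0 <= (`|V 0| + B) * sqnorm2 x by rewrite mulr_ge0// addr_ge0.
have h4 : 0 <= (B + C) * d%:R by rewrite mulr_ge0// addr_ge0.
lra.
Qed.

End quadratic_growth.

(** The entropy part costs [ln (r^-d)] through the density bound; the potential part stays bounded
    for [r <= 1], by quadratic growth and the second moment of the discretization. *)
Lemma free_energy_discretization (R : realType) (d : nat) (V : 'rV[R]_d -> R)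
    (y : P2 R d) : bounded_second_derivatives V ->
  exists A : R, forall r, 0 < r -> r <= 1 -> exists z : P2 R d,
    W2 y z <= (d%:R + 1) * r /\
    (free_energy V z <= (ln ((r ^+ d)^-1) + A)%:E)%E.
Proof.
move=> /bounded_second_derivatives_quadratic[C C0 VC].
pose m2 := fine (\int[y]_x (sqnorm2 x)%:E).
have s0 (x : 'rV[R]_d) : (0 <= (sqnorm2 x)%:E)%E by rewrite lee_fin sqnorm2_ge0.
have m2E : (\int[y]_x (sqnorm2 x)%:E = m2%:E)%E.
  by rewrite fineK// ge0_fin_numE ?P2_moment// integral_ge0.
exists (C + C * (2 * m2 + 2 * d%:R)) => r r0 r1.
have [z [yz zm zf zM]] := exists_discretization y r0.
exists z; split=> //; rewrite /free_energy EFinD; apply: leeD.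
  apply: entropy_le zM zf.
  by rewrite invf_ge1 ?exprn_gt0// exprn_ile1// ltW.
apply: (@le_trans _ _ (\int[z]_x (C%:E + C%:E * (sqnorm2 x)%:E))%E).
  apply: le_integral_nonmeasurable => x _.
    by rewrite adde_ge0 ?mule_ge0 ?lee_fin ?sqnorm2_ge0.
  by rewrite -EFinM -EFinD lee_fin VC.
have C0E : (0 <= C%:E)%E by rewrite lee_fin.
have ms := @measurable_sqnorm2_id R d.
rewrite ge0_integralD//; last 2 first.
- by move=> x _; exact: mule_ge0.
- exact: measurable_funeM.
rewrite ge0_integralZl// integral_cst// [X in (_ * X + _)%E]probability_setT mule1.
rewrite EFinD; apply: leeD => //; rewrite EFinM; apply: lee_wpmul2l => //.
apply: (le_trans zm); rewrite m2E -EFinM -EFinD lee_fin lerD2l.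
by apply: ler_piMr; [rewrite mulr_ge0|rewrite exprn_ile1// ltW].
Qed.

(** From [ln x <= x - 1] at [x = 1 / s]. It absorbs the logarithm in the energy bound near the
    start. *)
Lemma ln_inv_mul_le1 (R : realType) (s : R) : 0 < s -> s * ln s^-1 <= 1.
Proof.
move=> s0; have s'0 : 0 < s^-1 by rewrite invr_gt0.
have := @le_ln1Dx R (s^-1 - 1) ltac:(lra); rewrite addrC subrK => h.
apply: (@le_trans _ _ (s * s^-1)); last by rewrite mulfV// gt_eqF.
by apply: ler_wpM2l; [exact: ltW|lra].
Qed.

(** * Joining points of [Y] through the minimiser *)

Theorem proposition3p6 (R : realType) (d : nat) (lambda : R)
    (V : 'rV[R]_d -> R) (Y : set (P2 R d)) :
  let E := free_energy V in
  0 < lambda ->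
  lambda_convex lambda V ->
  bounded_second_derivatives V ->
  (exists c : R, forall x, (c%:E <= E x)%E) ->
  domain E !=set0 ->
  (forall y, Y y -> dist_closure (@W2 R d) (domain E) y ->
    exists gamma : R -> P2 R d,
      [/\ EVI_flow (@W2 R d) lambda E gamma,
          starts_from (@W2 R d) E gamma y &
          forall t : R, 0 < t -> Y (gamma t)]) ->
  (exists2 ystar, Y ystar & E ystar = ereal_inf (range E)) ->
  forall y1 y2, Y y1 -> Y y2 ->
    (induced_length_dist (@W2 R d) Y y1 y2 < +oo)%E.
Proof.
move=> E lambda0 _ V2 [c Ec] [x1 Ex1] flow [x0 Yx0 Ex0] y1 y2 Yy1 Yy2.
have Ex0le x : (E x0 <= E x)%E by rewrite Ex0; apply: ereal_inf_lbound; exists x.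
have fin x : (E x < +oo)%E -> E x = (fine (E x))%:E.
  by move=> Exoo; rewrite fineK// fin_real// Exoo (lt_le_trans (ltNyr c) (Ec x)).
have x0E := fin x0 (le_lt_trans (Ex0le x1) Ex1).
set m := fine (E x0) in x0E.
suff conn y : Y y -> lipschitz_connected (@W2 R d) Y y x0.
  apply: (lipschitz_connected_length (@W2_ge0 R d) (@W2_sym R d)).
  apply: (lipschitz_connected_trans (@W2_ge0 R d) (@W2_triangle R d) (conn y1 Yy1)).
  exact: (lipschitz_connected_sym (@W2_sym R d) (conn y2 Yy2)).
move=> Yy; have [A AP] := free_energy_discretization y V2.
have d0 : 0 < d%:R + 1 :> R by rewrite ltr_wpDl.
have [e e0|g [gE [gy _] gY]] := flow y Yy.
  (* Discretizations have finite energy, and this side puts them within [e / 2] of [y], so [y] lies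
     in the closure of the domain. *)
  pose r := Num.min 1 (e / 2 / (d%:R + 1)).
  have r0 : 0 < r by rewrite lt_min ltr01 !divr_gt0.
  have r1 : r <= 1 by rewrite ge_min lexx.
  have [z [yz zE]] := AP r r0 r1; exists z.
    exact: le_lt_trans zE (ltry _).
  rewrite W2_sym; apply: le_lt_trans yz _.
  apply: (@le_lt_trans _ _ ((d%:R + 1) * (e / 2 / (d%:R + 1)))).
    by rewrite ler_pM2l// ge_min lexx orbT.
  by rewrite mulrC divfK ?gt_eqF//; lra.
have mE t : 0 < t -> m <= fine (E (g t)).
  by move=> t0; rewrite -lee_fin -x0E -(EVI_flow_fine gE t0).
apply: (lipschitz_connected_trans (@W2_ge0 R d) (@W2_triangle R d) (y := g 1)); last first.
  apply: (lipschitz_connected_sym (@W2_sym R d)).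
  exact: (EVI_flow_connected_min (@W2_ge0 R d) (@W2_refl R d) (@W2_sym R d)
    (@W2_triangle R d) lambda0 gE mE x0E).
(* The three terms of [C] come from the squared transport distance divided by [2 * s ^+ 4], from the
   bounded part of the energy excess, and from [2 * d * (s * ln (1 / s)) <= 2 * d]. *)
apply: (EVI_flow_connected_start (C := (d%:R + 1) ^+ 2 / 2 + `|A - m| + 2 * d%:R)
  (@W2_ge0 R d) (@W2_refl R d) (@W2_sym R d) (@W2_triangle R d) lambda0 gE mE gY Yy gy).
move=> s s0 s1.
(* Side [s ^+ 2] at time [s ^+ 4] balances the squared distance against the time. *)
have [z [yz zE]] := AP (s ^+ 2) (exprn_gt0 _ s0) (exprn_ile1 _ (ltW s0) s1).
have zfin := fin z (le_lt_trans zE (ltry _)).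
rewrite -/(E z) zfin lee_fin in zE.
have s4 : 0 < s ^+ 4 by exact: exprn_gt0.
have := EVI_flow_energy_le (@W2_ge0 R d) (@W2_refl R d) (@W2_sym R d)
  (@W2_triangle R d) lambda0 gE zfin s4 gy.
have yz2 : W2 y z ^+ 2 <= (d%:R + 1) ^+ 2 * s ^+ 4.
  have -> : (d%:R + 1) ^+ 2 * s ^+ 4 = ((d%:R + 1) * s ^+ 2) ^+ 2 by ring.
  by rewrite ler_pXn2r ?nnegrE ?W2_ge0// mulr_ge0 ?sqr_ge0// ltW.
move=> /le_trans/(_ yz2) h1.
have {}h1 : fine (E (g (s ^+ 4))) - fine (E z) <= (d%:R + 1) ^+ 2 / 2.
  rewrite -(ler_pM2l s4); lra.
have lnE : ln (((s ^+ 2) ^+ d)^-1) = 2 * d%:R * ln s^-1.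
  by rewrite -exprM -exprVn lnXn ?invr_gt0// -[LHS]mulr_natl natrM.
rewrite lnE in zE.
have h2 := ln_inv_mul_le1 s0.
have h3 : s * (fine (E (g (s ^+ 4))) - m) <=
    s * ((d%:R + 1) ^+ 2 / 2 + `|A - m| + 2 * d%:R * ln s^-1).
  by apply: ler_wpM2l; [exact: ltW|have := ler_norm (A - m); lra].
apply: (le_trans h3).
have h4 : 2 * d%:R * (s * ln s^-1) <= 2 * d%:R * 1 by apply: ler_wpM2l => //; rewrite mulr_ge0.
have h5 : ((d%:R + 1) ^+ 2 / 2 + `|A - m|) * s <= (d%:R + 1) ^+ 2 / 2 + `|A - m|.
  by apply: ler_piMr => //; rewrite addr_ge0// divr_ge0 ?sqr_ge0.
lra.
Qed.
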